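(* Let $M$ be a contact $CR$-submanifold of a Sasakian statistical manifold $(\bar M,\bar\nabla,\bar g,\phi,\xi)$, with distributions $D$ and $D^\perp$, which is mixed totally geodesic with respect to $\bar\nabla$ (respectively $\bar\nabla^*$). Then for all $X\in\Gamma(D)$ and all normal vector fields $V$: (i) $A_{\phi V}X=\phi A^*_VX$ (respectively $A^*_{\phi V}X=\phi A_VX$); (ii) $\nabla^{\perp}_X\phi V=\phi\nabla^{*\perp}_XV$ (respectively $\nabla^{*\perp}_X\phi V=\phi\nabla^{\perp}_XV$).
   Context: A statistical manifold $(\bar M,\bar\nabla,\bar g)$ is a smooth Riemannian manifold $(\bar M,\bar g)$ with a torsion-free affine connection $\bar\nabla$ such that $(\bar\nabla_X\bar g)(Y,Z)=(\bar\nabla_Y\bar g)(X,Z)$. The dual connection $\bar\nabla^*$ is defined by $X\bar g(Y,Z)=\bar g(\bar\nabla_XY,Z)+\bar g(Y,\bar\nabla^*_XZ)$. Let $\hat{\bar\nabla}$ be the Levi-Civita connection of $\bar g$ and $K(X,Y)=\bar\nabla_XY-\hat{\bar\nabla}_XY$. An almost contact metric structure on an odd-dimensional $(\bar M,\bar g)$ consists of a $(1,1)$-tensor $\phi$, a unit vector field $\xi$ and a 1-form $\eta$ with $\phi^2X=-X+\eta(X)\xi$, $\bar g(X,\xi)=\eta(X)$, $\bar g(\phi X,\phi Y)=\bar g(X,Y)-\eta(X)\eta(Y)$ (so $\phi\xi=0$, $\eta\circ\phi=0$, $\bar g(\phi X,Y)=-\bar g(X,\phi Y)$). A Sasakian statistical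 manifold $(\bar M,\bar\nabla,\bar g,\phi,\xi)$ is a statistical manifold with an almost contact metric structure such that $\hat{\bar\nabla}_X\xi=\phi X$, $(\hat{\bar\nabla}_X\phi)Y=\bar g(Y,\xi)X-\bar g(Y,X)\xi$ and $K(X,\phi Y)+\phi K(X,Y)=0$. Consequently $\bar\nabla_X\phi Y-\phi\bar\nabla^*_XY=\bar g(Y,\xi)X-\bar g(Y,X)\xi$ and $\bar\nabla_X\xi=\phi X+\bar g(\bar\nabla_X\xi,\xi)\xi$, and the same identities hold with $\bar\nabla$ and $\bar\nabla^*$ interchanged. For a submanifold $M$ with induced metric $g$ ($g$ also denotes $\bar g$ on normal vectors), $X,Y\in\Gamma(TM)$ and $V\in\Gamma(T^\perp M)$, split into tangential and normal parts: $\bar\nabla_XY=\nabla_XY+h(X,Y)$, $\bar\nabla^*_XY=\nabla^*_XY+h^*(X,Y)$, $\bar\nabla_XV=-A_VX+\nabla^\perp_XV$, $\bar\nabla^*_XV=-A^*_VX+\nabla^{*\perp}_XV$. One has $g(A_VX,Y)=g(h^*(X,Y),V)$ and $g(A^*_VX,Y)=g(h(X,Y),V)$. Under the hypothesis of the theorem $\phi V$ is a normal vector field: taking $X=\xi$, mixed total geodesy forces the normal part of $\phi Z$, which equals both $h(Z,\xi)$ and $h^*(Z,\xi)$, to vanish for $Z\in\Gamma(D^\perp)$, so that $A_{\phi V}$, $A^*_{\phi V}$, $\nabla^\perp_X\phi V$ and $\nabla^{*\perp}_X\phi V$ are well defined. $M$ is a contact $CR$-submanifold if $TM=D\oplus D^\perp$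 for a differentiable distribution $D$ with $\xi\in\Gamma(D)$, $\phi(D_x)\subseteq D_x$, and with orthogonal complement $D^\perp$ satisfying $\phi(D^\perp_x)\subseteq T^\perp_xM$ for all $x\in M$. It is mixed totally geodesic with respect to $\bar\nabla$ (respectively $\bar\nabla^*$) if $h(X,Y)=0$ (respectively $h^*(X,Y)=0$) for all $X\in\Gamma(D)$ and $Y\in\Gamma(D^\perp)$. *)

(* Defs.v *)
From HB Require Import structures.
From mathcomp Require Export all_boot all_order all_algebra.
From mathcomp Require Export all_classical all_reals all_analysis.
Export Order.TTheory GRing.Theory Num.Theory.
Export numFieldNormedType.Exports.

Set Implicit Arguments.
Unset Strict Implicit.
Unset Printing Implicit Defensive.

Local Open Scope classical_set_scope.
Local Open Scope ring_scope.

(* A smooth manifold carries an atlas indexed by its points: [chart_at p] is   *)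
(* a chart around [p] (every atlas can be indexed this way).  The tangent      *)
(* space at [p] is 'rV[R]_n, a tangent vector being given by its components in *)
(* [chart_at p].  A vector field is a total function M -> 'rV[R]_n, whose      *)
(* value at [q] is read in [chart_at q].  All smoothness conditions are local  *)
(* ("smooth on a neighborhood of p"), so that a field smooth at [p] stands for *)
(* a local smooth section around [p], with arbitrary values far from [p].      *)

Section smoothness.
Context {R : realType} {n : nat} {W : normedModType R}.

Fixpoint iter_deriv (s : seq 'rV[R]_n) (F : 'rV[R]_n -> W) : 'rV[R]_n -> W :=
  if s is v :: s' then fun x => 'D_v (iter_deriv s' F) x else F.

(* F is C^infty on a neighborhood of x: differentiability of all iterated      *)
(* directional derivatives also gives their continuity.                        *)
Definition smooth_at (F : 'rV[R]_n -> W) (x : 'rV[R]_n) : Prop :=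
  \forall y \near x, forall s, differentiable (iter_deriv s F) y.

End smoothness.

Record chart (R : realType) (n : nat) (T : topologicalType) := Chart {
  dom : set T;
  cod : set 'rV[R]_n;
  to_chart : T -> 'rV[R]_n;
  of_chart : 'rV[R]_n -> T;
  dom_open : open dom;
  cod_open : open cod;
  to_chart_cod : forall p, dom p -> cod (to_chart p);
  of_chart_dom : forall x, cod x -> dom (of_chart x);
  to_chartK : forall p, dom p -> of_chart (to_chart p) = p;
  of_chartK : forall x, cod x -> to_chart (of_chart x) = x;
  to_chart_continuous : {within dom, continuous to_chart};
  of_chart_continuous : {within cod, continuous of_chart} }.

Record manifold (R : realType) (n : nat) := Manifold {
  points :> topologicalType;
  manifold_hausdorff : hausdorff_space points;
  manifold_second_countable : @second_countable points;
  chart_at : points -> chart R n points;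
  mem_chart_at : forall p, dom (chart_at p) p;
  chart_compat : forall p q x, dom (chart_at p) x -> dom (chart_at q) x ->
    smooth_at (to_chart (chart_at q) \o of_chart (chart_at p))
              (to_chart (chart_at p) x) }.

Section calculus.
Context {R : realType} {n : nat} {M : manifold R n}.
Implicit Types (p q : M) (v : 'rV[R]_n) (X Y : M -> 'rV[R]_n).

(* Components in chart d of the vector at q whose components in c are v. *)
Definition change_coord (c d : chart R n M) q v : 'rV[R]_n :=
  'D_v (to_chart d \o of_chart c) (to_chart c q).

Definition smooth_fun_at p (f : M -> R) : Prop :=
  smooth_at (f \o of_chart (chart_at p) : 'rV[R]_n -> R^o)
            (to_chart (chart_at p) p).

(* v(f), the derivative of f along v in T_pM *)
Definition dirderiv p v (f : M -> R) : R :=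
  'D_v (f \o of_chart (chart_at p) : 'rV[R]_n -> R^o) (to_chart (chart_at p) p).

(* The expression of X in chart_at p. *)
Definition field_rep p X (x : 'rV[R]_n) : 'rV[R]_n :=
  let q := of_chart (chart_at p) x in
  change_coord (chart_at q) (chart_at p) q (X q).

Definition smooth_field_at p X : Prop :=
  smooth_at (field_rep p X) (to_chart (chart_at p) p).

Definition lie_bracket X Y p : 'rV[R]_n :=
  'D_(X p) (field_rep p Y) (to_chart (chart_at p) p)
  - 'D_(Y p) (field_rep p X) (to_chart (chart_at p) p).

(* The i-th coordinate vector field of chart_at p. *)
Definition coord_field p (i : 'I_n) : M -> 'rV[R]_n := fun q =>
  change_coord (chart_at p) (chart_at q) q (delta_mx 0 i).

(* A local section around p of the family of subspaces E of TM. *)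
Definition section_at (E : M -> set 'rV[R]_n) p X : Prop :=
  smooth_field_at p X /\ \forall q \near p, E q (X q).

Definition smooth_distribution (D : M -> {vspace 'rV[R]_n}) : Prop :=
  forall p, exists r (X : 'I_r -> M -> 'rV[R]_n),
    (forall i, smooth_field_at p (X i)) /\
    \forall q \near p, basis_of (D q) [tuple X i q | i < r].

End calculus.

Record riemannian_metric (R : realType) (n : nat) (M : manifold R n) :=
  RiemannianMetric {
  metric :> M -> 'rV[R]_n -> 'rV[R]_n -> R;
  metric_sym : forall p u v, metric p u v = metric p v u;
  metric_linear : forall p u, scalar (metric p u);
  metric_pos : forall p v, v != 0 -> 0 < metric p v v;
  metric_smooth : forall p (X Y : M -> 'rV[R]_n),
    smooth_field_at p X -> smooth_field_at p Y ->
    smooth_fun_at p (fun q => metric q (X q) (Y q)) }.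

Record endo_field (R : realType) (n : nat) (M : manifold R n) := EndoField {
  endo :> M -> 'rV[R]_n -> 'rV[R]_n;
  endo_linear : forall p, linear (endo p);
  endo_smooth : forall p (X : M -> 'rV[R]_n), smooth_field_at p X ->
    smooth_field_at p (fun q => endo q (X q)) }.

Record one_form (R : realType) (n : nat) (M : manifold R n) := OneForm {
  form :> M -> 'rV[R]_n -> R;
  form_linear : forall p, scalar (form p);
  form_smooth : forall p (X : M -> 'rV[R]_n), smooth_field_at p X ->
    smooth_fun_at p (fun q => form q (X q)) }.

(* [nb p v Y] is the covariant derivative at p of the field Y, smooth around   *)
(* p, along the vector v of T_pM.                                              *)
Record connection (R : realType) (n : nat) (M : manifold R n) := Connection {
  cov :> forall p : M, 'rV[R]_n -> (M -> 'rV[R]_n) -> 'rV[R]_n;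
  cov_linear : forall p Y, smooth_field_at p Y ->
    linear (fun v => cov p v Y);
  cov_add : forall p v Y Z, smooth_field_at p Y -> smooth_field_at p Z ->
    cov p v (fun q => Y q + Z q) = cov p v Y + cov p v Z;
  cov_leibniz : forall p v (f : M -> R) Y,
    smooth_fun_at p f -> smooth_field_at p Y ->
    cov p v (fun q => f q *: Y q) = dirderiv p v f *: Y p + f p *: cov p v Y;
  cov_smooth : forall p X Y, smooth_field_at p X -> smooth_field_at p Y ->
    smooth_field_at p (fun q => cov q (X q) Y) }.

Section statistical.
Context {R : realType} {n : nat} {M : manifold R n}.
Variable g : riemannian_metric M.
Implicit Types nb nbs lc : connection M.

Definition torsion_free nb : Prop := forall p (X Y : M -> 'rV[R]_n),
  smooth_field_at p X -> smooth_field_at p Y ->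
  nb p (X p) Y - nb p (Y p) X = lie_bracket X Y p.

(* (nabla_X g)(Y, Z) at p *)
Definition cov_metric nb p (X Y Z : M -> 'rV[R]_n) : R :=
  dirderiv p (X p) (fun q => g q (Y q) (Z q))
  - g p (nb p (X p) Y) (Z p) - g p (Y p) (nb p (X p) Z).

Definition statistical_structure nb : Prop :=
  torsion_free nb /\
  forall p (X Y Z : M -> 'rV[R]_n),
    smooth_field_at p X -> smooth_field_at p Y -> smooth_field_at p Z ->
    cov_metric nb p X Y Z = cov_metric nb p Y X Z.

Definition levi_civita lc : Prop :=
  torsion_free lc /\
  forall p (X Y Z : M -> 'rV[R]_n),
    smooth_field_at p X -> smooth_field_at p Y -> smooth_field_at p Z ->
    cov_metric lc p X Y Z = 0.

Definition dual_connections nb nbs : Prop :=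
  forall p (X Y Z : M -> 'rV[R]_n),
    smooth_field_at p X -> smooth_field_at p Y -> smooth_field_at p Z ->
    dirderiv p (X p) (fun q => g q (Y q) (Z q)) =
      g p (nb p (X p) Y) (Z p) + g p (Y p) (nbs p (X p) Z).

Variables (phi : endo_field M) (xi : M -> 'rV[R]_n) (eta : one_form M).

Record almost_contact_metric : Prop := {
  acm_odd : odd n;
  acm_xi_smooth : forall p, smooth_field_at p xi;
  acm_xi_unit : forall p, g p (xi p) (xi p) = 1;
  acm_phi2 : forall p v, phi p (phi p v) = - v + eta p v *: xi p;
  acm_eta : forall p v, g p v (xi p) = eta p v;
  acm_metric : forall p u v,
    g p (phi p u) (phi p v) = g p u v - eta p u * eta p v }.

(* K(X, Y) at p, lc being the Levi-Civita connection *)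
Definition difference_tensor nb lc p (X Y : M -> 'rV[R]_n) : 'rV[R]_n :=
  nb p (X p) Y - lc p (X p) Y.

Record sasakian_statistical nb lc : Prop := {
  sas_statistical : statistical_structure nb;
  sas_acm : almost_contact_metric;
  sas_levi_civita : levi_civita lc;
  sas_xi : forall p (X : M -> 'rV[R]_n), smooth_field_at p X ->
    lc p (X p) xi = phi p (X p);
  sas_phi : forall p (X Y : M -> 'rV[R]_n),
    smooth_field_at p X -> smooth_field_at p Y ->
    lc p (X p) (fun q => phi q (Y q)) - phi p (lc p (X p) Y) =
      g p (Y p) (xi p) *: X p - g p (Y p) (X p) *: xi p;
  sas_K : forall p (X Y : M -> 'rV[R]_n),
    smooth_field_at p X -> smooth_field_at p Y ->
    difference_tensor nb lc p X (fun q => phi q (Y q))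
      + phi p (difference_tensor nb lc p X Y) = 0 }.

End statistical.

(* M is immersed in N by iota; a vector field along iota (a section of the     *)
(* pull-back of TN) is a function V : M -> 'rV[R]_m, where V p is a vector of  *)
(* the tangent space of N at iota p.                                           *)
Section submanifold.
Context {R : realType} {n m : nat} {M : manifold R n} {N : manifold R m}.
Variable iota : M -> N.
Implicit Types (p : M) (v : 'rV[R]_n) (V : M -> 'rV[R]_m).

Definition map_rep p : 'rV[R]_n -> 'rV[R]_m :=
  to_chart (chart_at (iota p)) \o iota \o of_chart (chart_at p).

Definition pushforward p v : 'rV[R]_m :=
  'D_v (map_rep p) (to_chart (chart_at p) p).

Definition immersion : Prop :=
  [/\ continuous iota,
      forall p, smooth_at (map_rep p) (to_chart (chart_at p) p)
    & forall p, injective (pushforward p)].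

(* The expression of V in the charts at p and at iota p. *)
Definition along_rep p V (x : 'rV[R]_n) : 'rV[R]_m :=
  let q := of_chart (chart_at p) x in
  change_coord (chart_at (iota q)) (chart_at (iota p)) (iota q) (V q).

Definition smooth_along_at p V : Prop :=
  smooth_at (along_rep p V) (to_chart (chart_at p) p).

(* Covariant derivative of a field along iota.  If V = \sum_i V^i d_i near p,  *)
(* with d_i the coordinate fields of the chart of N at iota p, then            *)
(*   nb_v V = \sum_i (v(V^i) d_i + V^i nb_{iota_* v} d_i),                     *)
(* so that nb_v V = nb_{iota_* v} W when V = W \o iota near p.                 *)
Definition cov_along (nb : connection N) p v V : 'rV[R]_m :=
  'D_v (along_rep p V) (to_chart (chart_at p) p)
  + \sum_(i < m) V p 0 i *:
      nb (iota p) (pushforward p v) (coord_field (iota p) i).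

Variable g : riemannian_metric N.

Definition induced_metric p (u v : 'rV[R]_n) : R :=
  g (iota p) (pushforward p u) (pushforward p v).

Definition normal p : set 'rV[R]_m :=
  [set w | forall v, g (iota p) w (pushforward p v) = 0].

Definition normal_field_at p V : Prop :=
  smooth_along_at p V /\ \forall q \near p, normal q (V q).

(* w = pushforward (tangential w) + normal_part w, the second term being       *)
(* normal; for an immersion there is exactly one such tangential part.         *)
Definition tangential p (w : 'rV[R]_m) : 'rV[R]_n :=
  xget 0 [set v | normal p (w - pushforward p v)].

Definition normal_part p (w : 'rV[R]_m) : 'rV[R]_m :=
  w - pushforward p (tangential p w).

Definition second_fundamental_form nb (X Y : M -> 'rV[R]_n) p : 'rV[R]_m :=
  normal_part p (cov_along nb p (X p) (fun q => pushforward q (Y q))).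

Definition shape_operator nb V (X : M -> 'rV[R]_n) p : 'rV[R]_n :=
  - tangential p (cov_along nb p (X p) V).

Definition normal_connection nb (X : M -> 'rV[R]_n) V p : 'rV[R]_m :=
  normal_part p (cov_along nb p (X p) V).

Definition orthogonal_complement (D : M -> {vspace 'rV[R]_n}) p
  : set 'rV[R]_n := [set v | forall w, w \in D p -> induced_metric p v w = 0].

Record contact_CR (phi : endo_field N) (xi : N -> 'rV[R]_m)
    (D : M -> {vspace 'rV[R]_n}) : Prop := {
  cr_immersion : immersion;
  cr_smooth : smooth_distribution D;
  cr_xi : forall p, exists2 v, v \in D p & pushforward p v = xi (iota p);
  cr_invariant : forall p v, v \in D p ->
    exists2 w, w \in D p & phi (iota p) (pushforward p v) = pushforward p w;
  cr_anti_invariant : forall p v, orthogonal_complement D p v ->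
    normal p (phi (iota p) (pushforward p v)) }.

Definition mixed_totally_geodesic (nb : connection N)
    (D : M -> {vspace 'rV[R]_n}) : Prop :=
  forall p (X Y : M -> 'rV[R]_n),
    section_at (fun q => [set v | v \in D q]) p X ->
    section_at (orthogonal_complement D) p Y ->
    second_fundamental_form nb X Y p = 0.

End submanifold.

(* Main.v *)
From mathcomp Require Import ring lra.
Require Import Defs.
Set Implicit Arguments.
Unset Strict Implicit.
Unset Printing Implicit Defensive.

Local Open Scope classical_set_scope.
Local Open Scope ring_scope.

(** Why the theorem holds.  Write nb and nb* for the dual connections.  Their
    mean is the Levi-Civita connection lc (it is metric by duality and
    torsion-free because Codazzi's equation makes nb* torsion-free), so that
    nb = lc + K and nb* = lc - K, and the condition K(X, phi Y) + phi K(X, Y) = 0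
    turns the covariant derivative of phi for lc into
      nb_X (phi Y) - phi (nb*_X Y) = g(Y, xi) X - g(Y, X) xi
    and into the same identity with nb and nb* exchanged.  The situation is
    therefore symmetric in the two connections, and one proof serves both
    halves of the theorem.

    For a normal field V the right-hand side vanishes, since xi is tangent
    to the submanifold: nb_X (phi V) = phi (nb*_X V).  It remains to split this
    equation into tangent and normal parts, that is, to see that phi maps the
    tangent part of nb*_X V to a tangent vector and its normal part to a normal
    vector.

    - The tangent part of nb*_X V lies in D, which phi preserves: for Z in the
      orthogonal complement of D, duality gives
      g(nb*_X V, Z) = - g(V, nb_X Z) = - g(V, h(X, Z)) = 0.
    - phi preserves normal vectors as soon as phi Z = 0 for every Z orthogonal
      to D (phi is skew, and phi D is tangent).  Now phi Z is normal, and nb_Z xi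
      = phi Z + a xi for some scalar a, so that phi Z = h(Z, xi) = h(xi, Z),
      which vanishes.

    The second fundamental form must be evaluated on sections, whereas these
    arguments concern vectors at one point.  Extensions of a normal vector to a
    normal field, and of a vector orthogonal to D to a section of the
    orthogonal complement of D, come from [gram_orthogonal].  As the vector on
    the submanifold that corresponds to xi is only given pointwise, xi is
    compared with a smooth section of D that agrees with it at the given point,
    and [cov_tangent_normal_part] says that the normal parts of their
    derivatives agree.  The symmetry of h becomes [torsion_along], whose proof
    rests on the symmetry of the second derivatives of the immersion,
    [smooth_at_swap].

    The identities on the ambient manifold are transported to fields along the
    immersion ([dual_along], [sasaki_along]) by expanding these fields in the
    coordinate fields of one ambient chart.  That requires a calculus of smooth
    functions, whose closure under sums, products and composition follows from
    [generated_smooth]. *)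

(** * Directional derivatives *)

Lemma near_open (T : topologicalType) (x : T) (P : T -> Prop) :
  (\forall y \near x, P y) ->
  exists2 U : set T, open U /\ U x & forall y, U y -> P y.
Proof. by rewrite /prop_near1 nbhsE => -[U [oU Ux] UP]; exists U. Qed.

Lemma near_and (T : topologicalType) (x : T) (P Q : T -> Prop) :
  (\forall y \near x, P y) -> (\forall y \near x, Q y) ->
  \forall y \near x, P y /\ Q y.
Proof. exact: filterI. Qed.

Section directional_derivative.
Context {R : realType} {V W : normedModType R}.
Implicit Types (f g : V -> W) (x v : V).

(** The expansion of [f] to first order at [x] is one of [g]. *)
Lemma near_eq_differentiable f g x :
  (\forall y \near x, f y = g y) -> differentiable f x -> differentiable g x.
Proof.
move=> fg df; have fgx : f x = g x by exact: nbhs_singleton fg.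
have cdf := diff_continuous df.
have eg : g \o shift x = cst (g x) + 'd f x +o_ 0 id.
  apply/eqaddoP => e e0.
  have := (eqaddoP _ _ _ _).1 (diff_locally df) e e0.
  have : \forall h \near 0, f (h + x) = g (h + x).
    have : (fun h : V => h + x) @ 0 --> 0 + x.
      by apply: cvgD; [exact: cvg_id|exact: cvg_cst].
    by rewrite add0r => cx; exact: cx _ fg.
  by apply: filterS2 => h /= eh; rewrite /shift /= !fctE eh fgx.
have e : 'd g x = 'd f x :> (V -> W) by apply: diff_unique.
by apply/diff_locallyP; rewrite e; split.
Qed.

Lemma derive_fun_add f g x v : differentiable f x -> differentiable g x ->
  'D_v (fun y => f y + g y) x = 'D_v f x + 'D_v g x.
Proof. by move=> df dg; apply: deriveD; exact: diff_derivable. Qed.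

Lemma differentiable_fun_add f g x : differentiable f x -> differentiable g x ->
  differentiable (fun y => f y + g y) x.
Proof. exact: differentiableD. Qed.

Lemma derive_fun_sum r (F : 'I_r -> V -> W) x v :
  (forall i, differentiable (F i) x) ->
  'D_v (fun y => \sum_(i < r) F i y) x = \sum_(i < r) 'D_v (F i) x.
Proof.
move=> dF; rewrite -derive_sum; last by move=> i; exact: diff_derivable.
by congr ('D_v _ x); apply/funext => y; rewrite fct_sumE.
Qed.

Lemma differentiable_fun_sum r (F : 'I_r -> V -> W) x :
  (forall i, differentiable (F i) x) ->
  differentiable (fun y => \sum_(i < r) F i y) x.
Proof.
move=> dF; rewrite (_ : (fun y => _) = \sum_(i < r) F i).
  exact: differentiable_sum.
by apply/funext => y; rewrite fct_sumE.
Qed.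

Lemma derive_scale_const (k : V -> R^o) (w : W) x v : differentiable k x ->
  'D_v (fun y => k y *: w) x = 'D_v k x *: w.
Proof.
move=> dk; rewrite !deriveE //; last exact: differentiableZl.
by rewrite diffZl.
Qed.

Lemma derive_linear f x : differentiable f x -> linear (fun v => 'D_v f x).
Proof. by move=> df a u v; rewrite !deriveE // linearP. Qed.

End directional_derivative.

Lemma derive_comp {R : realType} {U V W : normedModType R}
    (f : U -> V) (h : V -> W) x v :
  differentiable f x -> differentiable h (f x) ->
  'D_v (h \o f) x = 'D_('D_v f x) h (f x).
Proof.
move=> df dh; rewrite !deriveE //; last exact: differentiable_comp.
by rewrite diff_comp.
Qed.

Lemma derive_fun_mul {R : realType} {V : normedModType R} (f g : V -> R^o) x v :
  differentiable f x -> differentiable g x ->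
  'D_v (fun y => f y * g y : R^o) x = 'D_v f x * g x + f x * 'D_v g x.
Proof.
move=> df dg; rewrite (_ : (fun y => _) = f * g) // deriveM; try exact: diff_derivable.
by rewrite addrC mulrC.
Qed.

Lemma differentiable_fun_mul {R : realType} {V : normedModType R}
    (f g : V -> R^o) x : differentiable f x -> differentiable g x ->
  differentiable (fun y => f y * g y : R^o) x.
Proof. exact: differentiableM. Qed.

Section rows.
Context {R : realType} {V : normedModType R} {m : nat}.
Implicit Types (F : V -> 'rV[R]_m) (x v : V).

Lemma differentiable_rowP F x :
  differentiable F x <-> forall i, differentiable (fun y => F y 0 i : R^o) x.
Proof.
split=> [dF i|dF].
  exact: (@differentiable_comp _ _ _ _ F (fun r : 'rV[R]_m => r 0 i : R^o))
    dF (differentiable_coord _ _ _).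
rewrite (_ : F = fun y => \sum_(i < m) (F y 0 i *: delta_mx 0 i)).
  by apply: differentiable_fun_sum => i; exact: differentiableZl.
by apply/funext => y; rewrite [LHS]row_sum_delta.
Qed.

Lemma derive_row F x v i : differentiable F x ->
  ('D_v F x) 0 i = 'D_v (fun y => F y 0 i : R^o) x.
Proof. by move=> dF; rewrite derive_mx ?mxE //; exact: diff_derivable. Qed.

End rows.

Lemma derive_sum_dir {R : realType} {n : nat} {W : normedModType R}
    (f : 'rV[R]_n -> W) x (v : 'rV[R]_n) : differentiable f x ->
  'D_v f x = \sum_(i < n) v 0 i *: 'D_(delta_mx 0 i) f x.
Proof.
move=> df; rewrite deriveE // {1}[v]row_sum_delta linear_sum.
by apply: eq_bigr => i _; rewrite linearZ deriveE.
Qed.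

(** * Calculus of smooth maps *)

Section smooth_on.
Context {R : realType} {n : nat}.

Definition smooth_on {W : normedModType R} (U : set 'rV[R]_n)
    (f : 'rV[R]_n -> W) :=
  forall s y, U y -> differentiable (iter_deriv s f) y.

Lemma smooth_atP (W : normedModType R) (f : 'rV[R]_n -> W) x :
  smooth_at f x <-> exists2 U : set 'rV[R]_n, open U /\ U x & smooth_on U f.
Proof.
split=> [|[U oU sU]].
  move=> /near_open[U oU sU]; exists U => //.
  by move=> s y Uy; exact: sU.
have : nbhs x U by exact: open_nbhs_nbhs.
by apply: filterS => y Uy s; exact: sU.
Qed.

Lemma smooth_on_sub (W : normedModType R) (f : 'rV[R]_n -> W) A B :
  A `<=` B -> smooth_on B f -> smooth_on A f.
Proof. by move=> AB sf s y /AB; exact: sf. Qed.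

(** Smoothness is the greatest property that implies differentiability and is
    stable under directional derivatives. *)
Lemma smooth_on_coind (W : normedModType R) (U : set 'rV[R]_n)
    (P : ('rV[R]_n -> W) -> Prop) :
  (forall f, P f -> forall y, U y -> differentiable f y) ->
  (forall f v, P f -> P ('D_v f)) -> forall f, P f -> smooth_on U f.
Proof.
move=> Pd PD f Pf s; suff /Pd : P (iter_deriv s f) by [].
by elim: s => //= v s; exact: PD.
Qed.

Lemma smooth_on_derive (W : normedModType R) U (f : 'rV[R]_n -> W) v :
  smooth_on U f -> smooth_on U ('D_v f).
Proof.
move=> sf s y Uy; suff -> : iter_deriv s ('D_v f) = iter_deriv (rcons s v) f.
  exact: sf.
by elim: s => //= w s ->.
Qed.

Lemma smooth_on_diff (W : normedModType R) U (f : 'rV[R]_n -> W) y :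
  smooth_on U f -> U y -> differentiable f y.
Proof. by move=> sf; exact: (sf [::]). Qed.

Lemma smooth_on_ext (W : normedModType R) (U : set 'rV[R]_n)
    (f g : 'rV[R]_n -> W) : open U ->
  (forall y, U y -> f y = g y) -> smooth_on U f -> smooth_on U g.
Proof.
move=> oU fg sf.
apply: (@smooth_on_coind _ U (fun h => exists2 k, smooth_on U k &
  forall y, U y -> k y = h y)); last by exists f.
- move=> h [k sk kh] y Uy; apply: near_eq_differentiable (smooth_on_diff sk Uy).
  by apply: filterS kh _; exact: open_nbhs_nbhs.
- move=> h v [k sk kh]; exists ('D_v k); first exact: smooth_on_derive.
  move=> y Uy; apply: near_eq_derive; apply: filterS kh _.
  exact: open_nbhs_nbhs.
Qed.

Lemma smooth_on_cst (W : normedModType R) U (c : W) : smooth_on U (fun=> c).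
Proof.
apply: (@smooth_on_coind _ U (fun h => exists c, h = fun=> c)); last by exists c.
- by move=> f [d ->] y _; exact: differentiable_cst.
- by move=> f v [d ->]; exists 0; apply/funext => y; exact: derive_cst.
Qed.

End smooth_on.

Section closure_of_smooth_on.
Context {R : realType} {n : nat}.

(** The derivative of a product or of a composite is a sum of products: neither
    class is stable under derivatives, but the algebra that they generate is,
    and coinduction applies to it.  In a composite both factors are smooth
    rather than generated; this is enough because a partial derivative of a
    smooth function is smooth. *)
Inductive generated (U : set 'rV[R]_n) : ('rV[R]_n -> R^o) -> Prop :=
| generated_base f : smooth_on U f -> generated U f
| generated_ext f g : generated U f -> (forall y, U y -> f y = g y) ->
    generated U g
| generated_add f g : generated U f -> generated U g ->
    generated U (fun y => f y + g y)
| generated_mul f g : generated U f -> generated U g ->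
    generated U (fun y => f y * g y)
| generated_comp m (A : set 'rV[R]_m) (F : 'rV[R]_n -> 'rV[R]_m)
    (f : 'rV[R]_m -> R^o) :
    (forall i, smooth_on U (fun y => F y 0 i : R^o)) ->
    (forall y, U y -> A (F y)) -> smooth_on A f -> generated U (f \o F).

Lemma generated_sum U r (F : 'I_r -> 'rV[R]_n -> R^o) :
  (forall i, generated U (F i)) -> generated U (fun y => \sum_(i < r) F i y).
Proof.
elim: r F => [F _|r IH F gF].
  apply: (@generated_ext _ (fun=> 0)); first exact/generated_base/smooth_on_cst.
  by move=> y _; rewrite big_ord0.
apply: (@generated_ext _ (fun y => F ord0 y + \sum_(i < r) F (lift ord0 i) y)).
  by apply: generated_add => //; exact: IH.
by move=> y _; rewrite big_ord_recl.
Qed.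

Lemma generated_diff U f : open U -> generated U f ->
  forall y, U y -> differentiable f y.
Proof.
move=> oU; elim=> {f} [f sf y|f g _ IH fg y Uy|f g _ IHf _ IHg y Uy
    |f g _ IHf _ IHg y Uy|m A F f sF UA sf y Uy].
- exact: smooth_on_diff.
- apply: near_eq_differentiable (IH _ Uy).
  by apply: filterS fg _; exact: open_nbhs_nbhs.
- by apply: differentiable_fun_add; [exact: IHf|exact: IHg].
- by apply: differentiable_fun_mul; [exact: IHf|exact: IHg].
- apply: differentiable_comp; last exact: smooth_on_diff sf (UA _ Uy).
  by apply/differentiable_rowP => i; exact: smooth_on_diff (sF i) Uy.
Qed.

Lemma generated_derive U f v : open U -> generated U f -> generated U ('D_v f).
Proof.
move=> oU; elim=> {f} [f sf|f g gf IH fg|f g gf IHf gg IHg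
    |f g gf IHf gg IHg|m A F f sF UA sf].
- by apply: generated_base; exact: smooth_on_derive.
- apply: generated_ext IH _ => y Uy; apply: near_eq_derive.
  by apply: filterS fg _; exact: open_nbhs_nbhs.
- apply: generated_ext (generated_add IHf IHg) _ => y Uy.
  by rewrite derive_fun_add //; exact: generated_diff Uy.
- apply: generated_ext (generated_add (generated_mul IHf gg)
    (generated_mul gf IHg)) _ => y Uy.
  by rewrite derive_fun_mul //; exact: generated_diff Uy.
- apply: (@generated_ext _ (fun y => \sum_(i < m)
    'D_v (fun z => F z 0 i : R^o) y * ('D_(delta_mx 0 i) f \o F) y)).
    apply: generated_sum => i; apply: generated_mul.
      by apply: generated_base; exact: smooth_on_derive.
    by apply: (@generated_comp _ _ A) => //; exact: smooth_on_derive.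
  move=> y Uy.
  have dF : differentiable F y.
    by apply/differentiable_rowP => i; exact: smooth_on_diff (sF i) Uy.
  have df : differentiable f (F y) by exact: smooth_on_diff sf (UA _ Uy).
  rewrite derive_comp // [RHS]derive_sum_dir //.
  by apply: eq_bigr => i _; rewrite derive_row.
Qed.

Lemma generated_smooth U f : open U -> generated U f -> smooth_on U f.
Proof.
move=> oU; apply: smooth_on_coind => {}f; first exact: generated_diff.
by move=> v; exact: generated_derive.
Qed.

Lemma smooth_on_row m U (F : 'rV[R]_n -> 'rV[R]_m) : open U ->
  smooth_on U F <-> forall i, smooth_on U (fun y => F y 0 i : R^o).
Proof.
move=> oU; split=> [sF i|sF].
- apply: (@smooth_on_coind _ _ _ U (fun h => exists2 G, smooth_on U G &
    forall y, U y -> h y = (G y : 'rV[R]_m) 0 i)); last by exists F.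
  + move=> h [G sG hG] y Uy.
    have dG : differentiable (fun y => G y 0 i : R^o) y.
      by move: i {hG}; apply/differentiable_rowP; exact: smooth_on_diff sG Uy.
    apply: near_eq_differentiable dG; near=> z; apply/esym/hG.
    by near: z; exact: open_nbhs_nbhs.
  + move=> h v [G sG hG]; exists ('D_v G); first exact: smooth_on_derive.
    move=> y Uy; rewrite derive_row; last exact: smooth_on_diff sG Uy.
    by apply: near_eq_derive; apply: filterS hG _; exact: open_nbhs_nbhs.
- apply: (@smooth_on_coind _ _ _ U (fun G =>
    forall i, smooth_on U (fun y => (G y : 'rV[R]_m) 0 i : R^o))) => //.
  + move=> G sG y Uy; apply/differentiable_rowP => i.
    exact: smooth_on_diff (sG i) Uy.
  + move=> G v sG i; apply: smooth_on_ext (smooth_on_derive v (sG i)) => //.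
    move=> y Uy; rewrite derive_row //; apply/differentiable_rowP => j.
    exact: smooth_on_diff (sG j) Uy.
Unshelve. all: by end_near. Qed.

End closure_of_smooth_on.

Section smooth_at.
Context {R : realType} {n : nat}.
Implicit Types x : 'rV[R]_n.

Lemma smooth_at_diff (W : normedModType R) (f : 'rV[R]_n -> W) x :
  smooth_at f x -> differentiable f x.
Proof. by move=> /nbhs_singleton /(_ [::]). Qed.

Lemma smooth_at_near (W : normedModType R) (f : 'rV[R]_n -> W) x :
  smooth_at f x -> \forall y \near x, smooth_at f y.
Proof.
move=> /smooth_atP[U [oU Ux] sf].
have : nbhs x U by exact: open_nbhs_nbhs.
by apply: filterS => y Uy; apply/smooth_atP; exists U.
Qed.

Lemma smooth_at_ext (W : normedModType R) (f g : 'rV[R]_n -> W) x :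
  (\forall y \near x, f y = g y) -> smooth_at f x -> smooth_at g x.
Proof.
move=> /near_open[A [oA Ax] fg] /smooth_atP[U [oU Ux] sf].
apply/smooth_atP; exists (A `&` U); first by split=> //; exact: openI.
apply: (@smooth_on_ext _ _ _ _ f); [exact: openI|by move=> y []/fg|].
exact: smooth_on_sub sf.
Qed.

Lemma smooth_at_cst (W : normedModType R) (c : W) x : smooth_at (fun=> c) x.
Proof.
apply/smooth_atP; exists setT; last exact: smooth_on_cst.
by split=> //; exact: openT.
Qed.

Lemma smooth_at_derive (W : normedModType R) (f : 'rV[R]_n -> W) x v :
  smooth_at f x -> smooth_at ('D_v f) x.
Proof.
by move=> /smooth_atP[U oU sf]; apply/smooth_atP; exists U => //; exact: smooth_on_derive.
Qed.

Lemma smooth_at_add (f g : 'rV[R]_n -> R^o) x :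
  smooth_at f x -> smooth_at g x -> smooth_at (fun y => f y + g y : R^o) x.
Proof.
move=> /smooth_atP[U [oU Ux] sf] /smooth_atP[A [oA Ax] sg]; apply/smooth_atP.
exists (U `&` A); first by split=> //; exact: openI.
by apply: generated_smooth; [exact: openI|];
  apply: generated_add; apply: generated_base; [move: sf|move: sg]; apply: smooth_on_sub.
Qed.

Lemma smooth_at_mul (f g : 'rV[R]_n -> R^o) x :
  smooth_at f x -> smooth_at g x -> smooth_at (fun y => f y * g y : R^o) x.
Proof.
move=> /smooth_atP[U [oU Ux] sf] /smooth_atP[A [oA Ax] sg]; apply/smooth_atP.
exists (U `&` A); first by split=> //; exact: openI.
by apply: generated_smooth; [exact: openI|];
  apply: generated_mul; apply: generated_base; [move: sf|move: sg]; apply: smooth_on_sub.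
Qed.

Lemma smooth_at_sum (I : Type) (r : seq I) (P : pred I)
    (F : I -> 'rV[R]_n -> R^o) x :
  (forall i, smooth_at (F i) x) ->
  smooth_at (fun y => \sum_(i <- r | P i) F i y : R^o) x.
Proof.
move=> sF; elim: r => [|i r IH].
  by under eq_fun do rewrite big_nil; exact: smooth_at_cst.
under eq_fun do rewrite big_cons; case: (P i) => //.
exact: smooth_at_add.
Qed.

Lemma smooth_at_prod (I : Type) (r : seq I) (P : pred I)
    (F : I -> 'rV[R]_n -> R^o) x :
  (forall i, smooth_at (F i) x) ->
  smooth_at (fun y => \prod_(i <- r | P i) F i y : R^o) x.
Proof.
move=> sF; elim: r => [|i r IH].
  by under eq_fun do rewrite big_nil; exact: smooth_at_cst.
under eq_fun do rewrite big_cons; case: (P i) => //.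
exact: smooth_at_mul.
Qed.

Lemma smooth_at_row m (F : 'rV[R]_n -> 'rV[R]_m) x :
  smooth_at F x <-> forall i, smooth_at (fun y => F y 0 i : R^o) x.
Proof.
split=> [/smooth_atP[U oU sF] i|sF].
  apply/smooth_atP; exists U => //; move: i; apply/smooth_on_row => //.
  by case: oU.
have := @filter_forall _ _ (fun i y => forall s,
  differentiable (iter_deriv s (fun y => F y 0 i : R^o)) y) (nbhs x) (nbhs_filter x) sF.
move=> sU'; have [U oU sU] := near_open sU'; apply/smooth_atP; exists U => //.
apply/smooth_on_row; first by case: oU.
by move=> i s y Uy; exact: sU.
Qed.

Lemma smooth_at_comp m (F : 'rV[R]_n -> 'rV[R]_m) (f : 'rV[R]_m -> R^o) x :
  smooth_at F x -> smooth_at f (F x) -> smooth_at (f \o F) x.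
Proof.
move=> sF /smooth_atP[A [oA AF] sf].
have cF : {for x, continuous F} by apply: differentiable_continuous; exact: smooth_at_diff.
have nA : nbhs x (F @^-1` A) by apply: cF; exact: open_nbhs_nbhs.
move: nA; rewrite nbhsE => -[B [oB Bx] BA].
move/smooth_atP: sF => [U [oU Ux] sF]; apply/smooth_atP.
exists (U `&` B); first by split=> //; exact: openI.
apply: generated_smooth; first exact: openI.
apply: (@generated_comp _ _ _ _ A) => //.
  apply/smooth_on_row; first exact: openI.
  by move: sF; apply: smooth_on_sub.
by move=> y [_ /BA].
Qed.

End smooth_at.

(** * Symmetry of second derivatives *)

Section symmetry_of_second_derivatives.
Context {R : realType} {V : normedModType R}.
Implicit Types (f : V -> R^o) (x u v : V).

Lemma is_derive_line f x u t : differentiable f (x + t *: u) ->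
  is_derive (t : R^o) 1 (fun s : R^o => f (x + s *: u)) ('D_u f (x + t *: u)).
Proof.
move=> df.
have du : differentiable (fun s : R^o => s *: u) t.
  exact: (@differentiableZl _ R^o V id).
have da : differentiable (fun s : R^o => x + s *: u) t.
  exact: differentiable_fun_add.
have := @derive_comp R R^o V R^o (fun s : R^o => x + s *: u) f t 1 da df.
rewrite (derive_fun_add _ (differentiable_cst x t) du) derive_cst add0r.
rewrite (@derive_scale_const _ R^o V id); last exact: ex_diff.
rewrite derive_id scale1r => <-.
by apply: DeriveDef => //; apply: diff_derivable; exact: differentiable_comp da df.
Qed.

Lemma mean_value_line f x u (h : R) : 0 < h ->
  (forall t, 0 <= t <= h -> differentiable f (x + t *: u)) ->
  exists2 t, 0 <= t <= h & f (x + h *: u) - f x = h * 'D_u f (x + t *: u).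
Proof.
move=> h0 df.
have [||t] := @MVT R (fun s => f (x + s *: u)) (fun t => 'D_u f (x + t *: u)) 0 h h0.
- move=> t; rewrite in_itv /= => /andP[t0 th]; apply: is_derive_line.
  by apply: df; rewrite !ltW.
- apply: derivable_within_continuous => t; rewrite in_itv /= => tI.
  by have [] := is_derive_line (df t tI).
- rewrite in_itv /= => /andP[t0 th]; rewrite scale0r addr0 subr0 mulrC => e.
  by exists t => //; rewrite !ltW.
Qed.

(** The mean value theorem is used along [u] for the increment of [f] in the
    direction [v], and then along [v] for its derivative. *)
Lemma mixed_difference f x u v (h : R) : 0 < h ->
  (forall a b, 0 <= a <= h -> 0 <= b <= h ->
    differentiable f (x + a *: u + b *: v) /\
    differentiable ('D_u f) (x + a *: u + b *: v)) ->
  exists a b, [/\ 0 <= a <= h, 0 <= b <= h &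
    f (x + h *: u + h *: v) - f (x + h *: u) - (f (x + h *: v) - f x) =
    h * (h * 'D_v ('D_u f) (x + a *: u + b *: v))].
Proof.
move=> h0 df.
have hh : 0 <= h <= h by rewrite lexx ltW.
have h00 : 0 <= (0 : R) <= h by rewrite lexx ltW.
pose k y := f (y + h *: v) - f y : R^o.
have shift_diff a : 0 <= a <= h ->
    differentiable (fun y => f (y + h *: v)) (x + a *: u) /\
    'D_u (fun y => f (y + h *: v)) (x + a *: u) = 'D_u f (x + a *: u + h *: v).
  move=> aI; have [dfa _] := df a h aI hh.
  have di : differentiable (fun y : V => y) (x + a *: u) by exact: ex_diff.
  have ds : differentiable (fun y : V => y + h *: v) (x + a *: u).
    exact: differentiable_fun_add.
  split; first exact: (differentiable_comp ds dfa).
  have := @derive_comp R V V R^o (fun y => y + h *: v) f (x + a *: u) u ds dfa.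
  rewrite (derive_fun_add _ di (differentiable_cst (h *: v) _)).
  by rewrite derive_cst addr0 derive_id.
have dk a : 0 <= a <= h -> differentiable k (x + a *: u) /\
    'D_u k (x + a *: u) = 'D_u f (x + a *: u + h *: v) - 'D_u f (x + a *: u).
  move=> aI; have [ds es] := shift_diff a aI.
  have [dfa _] := df a 0 aI h00; rewrite scale0r addr0 in dfa.
  split; first exact: differentiableB.
  by rewrite -es; apply: deriveB; exact: diff_derivable.
have [|a aI ea] := @mean_value_line k x u h h0; first by move=> t /dk[].
have [|b bI eb] := @mean_value_line ('D_u f) (x + a *: u) v h h0.
  by move=> b bI; have [] := df a b aI bI.
exists a, b; split=> //.
by move: ea; rewrite (dk a aI).2 eb.
Qed.

(** Both iterated derivatives are values of one and the same mixed second
    difference, at points that tend to [x] with the step. *)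
Lemma derive_swap f x u v :
  (\forall y \near x, [/\ differentiable f y, differentiable ('D_u f) y
    & differentiable ('D_v f) y]) ->
  {for x, continuous ('D_v ('D_u f))} -> {for x, continuous ('D_u ('D_v f))} ->
  'D_u ('D_v f) x = 'D_v ('D_u f) x.
Proof.
move=> df cvu cuv; apply/eqP; rewrite -subr_eq0 -normr_le0.
apply/ler_addgt0Pl => e e0; rewrite addr0.
have e2 : 0 < e / 2 by rewrite divr_gt0.
move/cvgrPdist_le : cvu => /(_ _ e2) nvu.
move/cvgrPdist_le : cuv => /(_ _ e2) nuv.
have [d /= d0 dP] := (nbhs_ballP _ _).1 (filterI df (filterI nvu nuv)).
have k0 : 0 < `|u| + `|v| + 1 by rewrite ltr_wpDl ?ltr01 ?addr_ge0.
(* The parallelogram of side [h] at [x] stays in the ball of radius [d]. *)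
pose h := d / 2 / (`|u| + `|v| + 1).
have h0 : 0 < h by rewrite !divr_gt0.
have inball a b (w w' : V) : `|w| + `|w'| = `|u| + `|v| ->
    0 <= a <= h -> 0 <= b <= h -> ball x d (x + a *: w + b *: w').
  move=> eww /andP[a0 ah] /andP[b0 bh]; rewrite -ball_normE /ball_ /=.
  rewrite -addrA opprD addrA subrr add0r normrN.
  apply: (le_lt_trans (ler_normD _ _)); rewrite !normrZ !ger0_norm //.
  apply: (@le_lt_trans _ _ (h * (`|u| + `|v|))).
    by rewrite -eww mulrDr lerD // ler_wpM2r.
  apply: (@le_lt_trans _ _ (d / 2)).
    rewrite /h -mulrA; apply: ler_piMr; first by rewrite divr_ge0 ?ltW.
    by rewrite mulrC ler_pdivrMr // mul1r lerDl.
  by rewrite ltr_pdivrMr // ltr_pMr // ltr1n.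
have [|a [b [aI bI e1]]] := @mixed_difference f x u v h h0.
  by move=> a b aI bI; have [[? ? ?] _] := dP _ (inball a b u v erefl aI bI).
have [|b' [a' [bI' aI' e2']]] := @mixed_difference f x v u h h0.
  by move=> b' a' aI' bI'; have [[? ? ?] _] := dP _ (inball b' a' v u (addrC _ _) aI' bI').
have cancel (p q : R) : h * (h * p) = h * (h * q) -> p = q.
  by move=> e1'; have hn0 : h != 0; [rewrite gt_eqF | do 2 apply: (mulfI hn0)].
set p := x + a *: u + b *: v in e1.
set q := x + b' *: v + a' *: u in e2'.
have eD : 'D_v ('D_u f) p = 'D_u ('D_v f) q.
  apply: cancel; apply: etrans (esym e1) _; apply: etrans _ e2'.
  rewrite [x + h *: v + _]addrAC !opprB [LHS]addrACA [RHS]addrACA.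
  by rewrite [- f (x + h *: u) + _]addrC.
have [_ [n1 _]] := dP _ (inball a b u v erefl aI bI).
have [_ [_ n2]] := dP _ (inball b' a' v u (addrC _ _) bI' aI').
have {}n1 : `|'D_u ('D_v f) q - 'D_v ('D_u f) x| <= e / 2.
  by rewrite -eD distrC; exact: n1.
rewrite -(subrKA ('D_u ('D_v f) q)) (splitr e).
by apply: (le_trans (ler_normD _ _)); apply: lerD; [exact: n2|exact: n1].
Qed.

End symmetry_of_second_derivatives.

Lemma smooth_at_swap {R : realType} {n m : nat} (F : 'rV[R]_n -> 'rV[R]_m)
    x u v : smooth_at F x -> 'D_u ('D_v F) x = 'D_v ('D_u F) x.
Proof.
move=> sF; apply/rowP => i.
have sFi := (smooth_at_row F x).1 sF i.
have eD w : \forall y \near x, ('D_w F y) 0 i = 'D_w (fun z => F z 0 i : R^o) y.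
  have := smooth_at_near sF; apply: filterS => y /smooth_at_diff.
  exact: derive_row.
have dD w := smooth_at_diff (smooth_at_derive w sF).
have eDD w w' : ('D_w ('D_w' F) x) 0 i = 'D_w ('D_w' (fun z => F z 0 i : R^o)) x.
  by rewrite (derive_row _ _ (dD w')); exact: near_eq_derive (eD w').
apply: etrans (eDD u v) (etrans _ (esym (eDD v u))); apply: derive_swap.
- have := smooth_at_near sFi; apply: filterS => y sy; split.
  + exact: smooth_at_diff.
  + by apply: smooth_at_diff; exact: smooth_at_derive.
  + by apply: smooth_at_diff; exact: smooth_at_derive.
- apply: differentiable_continuous; apply: smooth_at_diff.
  by do 2 apply: smooth_at_derive.
- apply: differentiable_continuous; apply: smooth_at_diff.
  by do 2 apply: smooth_at_derive.
Qed.

(** * Charts and changes of coordinates *)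

Section linear_functions.
Context {R : realType} {U V : lmodType R}.
Variables (f : U -> V) (lin_f : linear f).

Lemma linear_fun0 : f 0 = 0.
Proof.
by have := lin_f (-1) 0 0; rewrite !scaleN1r !addNr.
Qed.

Lemma linear_comb (I : Type) (r : seq I) (a : I -> R) (u : I -> U) :
  f (\sum_(i <- r) a i *: u i) = \sum_(i <- r) a i *: f (u i).
Proof.
elim: r => [|i r IH]; first by rewrite !big_nil linear_fun0.
by rewrite !big_cons lin_f IH.
Qed.

Lemma linear_funZ a u : f (a *: u) = a *: f u.
Proof. by have := lin_f a u 0; rewrite linear_fun0 !addr0. Qed.

Lemma linear_funD u w : f (u + w) = f u + f w.
Proof. by have := lin_f 1 u w; rewrite !scale1r. Qed.

Lemma linear_funN u : f (- u) = - f u.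
Proof. by rewrite -scaleN1r linear_funZ scaleN1r. Qed.

Lemma linear_funB u w : f (u - w) = f u - f w.
Proof. by rewrite linear_funD linear_funN. Qed.

End linear_functions.

Section charts.
Context {R : realType} {n : nat} {T : topologicalType}.
Implicit Types (c : chart R n T) (q : T) (x : 'rV[R]_n).

Lemma near_dom c q : dom c q -> \forall q' \near q, dom c q'.
Proof. by move=> cq; apply: open_nbhs_nbhs; split=> //; exact: dom_open. Qed.

Lemma near_cod c x : cod c x -> \forall y \near x, cod c y.
Proof. by move=> cx; apply: open_nbhs_nbhs; split=> //; exact: cod_open. Qed.

Lemma near_of_chart c q (P : T -> Prop) : dom c q ->
  (\forall q' \near q, P q') ->
  \forall x \near to_chart c q, cod c x /\ P (of_chart c x).
Proof.
move=> cq nP; have cx := to_chart_cod cq.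
apply: filterI; first exact: near_cod.
have := @of_chart_continuous _ _ _ c.
rewrite continuous_open_subspace; last exact: cod_open.
move=> /(_ (to_chart c q)); rewrite inE => /(_ cx); apply.
by rewrite /= to_chartK.
Qed.

End charts.

Section change_of_coordinates.
Context {R : realType} {n : nat} {M : manifold R n}.
Implicit Types (p q a b e : M) (v : 'rV[R]_n) (X Y : M -> 'rV[R]_n).

Notation loc p := (to_chart (chart_at p) p).

Lemma transition_diff a b q : dom (chart_at a) q -> dom (chart_at b) q ->
  differentiable (to_chart (chart_at b) \o of_chart (chart_at a))
    (to_chart (chart_at a) q).
Proof. by move=> qa qb; apply: smooth_at_diff; exact: chart_compat. Qed.

Lemma change_coord_linear a b q : dom (chart_at a) q -> dom (chart_at b) q ->
  linear (change_coord (chart_at a) (chart_at b) q).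
Proof. by move=> qa qb; apply: derive_linear; exact: transition_diff. Qed.

Lemma change_coord_id a q v : dom (chart_at a) q ->
  change_coord (chart_at a) (chart_at a) q v = v.
Proof.
move=> qa; rewrite /change_coord -[RHS](derive_id (to_chart (chart_at a) q)).
apply: near_eq_derive; have := near_cod (to_chart_cod qa).
by apply: filterS => y cy /=; rewrite of_chartK.
Qed.

(** The chain rule for transition maps. *)
Lemma change_coord_trans a b e q v : dom (chart_at a) q ->
  dom (chart_at b) q -> dom (chart_at e) q ->
  change_coord (chart_at b) (chart_at e) q
    (change_coord (chart_at a) (chart_at b) q v)
  = change_coord (chart_at a) (chart_at e) q v.
Proof.
move=> qa qb qe; rewrite {1 2}/change_coord.
have dab := transition_diff qa qb; have dbe := transition_diff qb qe.
have eq_b : (to_chart (chart_at b) \o of_chart (chart_at a))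
    (to_chart (chart_at a) q) = to_chart (chart_at b) q.
  by rewrite /= to_chartK.
rewrite -eq_b in dbe; rewrite -{1}eq_b.
apply: etrans (esym (derive_comp v dab dbe)) _; apply: near_eq_derive; have := near_of_chart qa (near_dom qb).
by apply: filterS => x [_ bx] /=; rewrite to_chartK.
Qed.

Lemma change_coordK a b q v : dom (chart_at a) q -> dom (chart_at b) q ->
  change_coord (chart_at b) (chart_at a) q
    (change_coord (chart_at a) (chart_at b) q v) = v.
Proof. by move=> qa qb; rewrite change_coord_trans // change_coord_id. Qed.

Lemma field_rep_center p X : field_rep p X (loc p) = X p.
Proof.
rewrite /field_rep to_chartK; last exact: mem_chart_at.
by rewrite change_coord_id //; exact: mem_chart_at.
Qed.

Lemma coord_field_center p i : coord_field p i p = delta_mx 0 i.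
Proof. by rewrite /coord_field change_coord_id //; exact: mem_chart_at. Qed.

Lemma coord_field_expansion p q v : dom (chart_at p) q ->
  v = \sum_i change_coord (chart_at q) (chart_at p) q v 0 i *: coord_field p i q.
Proof.
move=> pq; have qq := mem_chart_at q.
rewrite -{1}[v](change_coordK v qq pq).
set w := change_coord (chart_at q) (chart_at p) q v.
rewrite {1}[w]row_sum_delta.
by rewrite (linear_comb (change_coord_linear pq qq)).
Qed.

(** Transfers a property that holds near [p] to the coordinates in which fields
    and functions are differentiated. *)
Lemma field_rep_near p (P : M -> 'rV[R]_n -> Prop) :
  (\forall q \near p, P q (to_chart (chart_at p) q)) ->
  \forall x \near loc p, P (of_chart (chart_at p) x) x.
Proof.
move=> nP; have := near_of_chart (mem_chart_at p) nP.
by apply: filterS => x [cx]; rewrite of_chartK.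
Qed.

Lemma smooth_fun_local p (f h : M -> R) : (\forall q \near p, f q = h q) ->
  smooth_fun_at p f -> smooth_fun_at p h.
Proof.
move=> fh; apply: smooth_at_ext.
exact: (@field_rep_near p (fun q _ => f q = h q)).
Qed.

Lemma smooth_fun_cst p (a : R) : smooth_fun_at p (fun=> a).
Proof. exact: smooth_at_cst. Qed.

Lemma smooth_fun_mul p (f h : M -> R) : smooth_fun_at p f ->
  smooth_fun_at p h -> smooth_fun_at p (fun q => f q * h q).
Proof. exact: smooth_at_mul. Qed.

Lemma smooth_fun_sum p (I : Type) (r : seq I) (P : pred I) (f : I -> M -> R) :
  (forall i, smooth_fun_at p (f i)) ->
  smooth_fun_at p (fun q => \sum_(i <- r | P i) f i q).
Proof. exact: smooth_at_sum. Qed.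

Lemma smooth_fun_prod p (I : Type) (r : seq I) (P : pred I) (f : I -> M -> R) :
  (forall i, smooth_fun_at p (f i)) ->
  smooth_fun_at p (fun q => \prod_(i <- r | P i) f i q).
Proof. exact: smooth_at_prod. Qed.

Lemma dirderiv_local p v (f h : M -> R) : (\forall q \near p, f q = h q) ->
  dirderiv p v f = dirderiv p v h.
Proof.
move=> fh; apply: near_eq_derive.
exact: (@field_rep_near p (fun q _ => f q = h q)).
Qed.

Lemma dirderiv_cst p v (a : R) : dirderiv p v (fun=> a) = 0.
Proof. exact: derive_cst. Qed.

Lemma dirderiv_mul p v (f h : M -> R) : smooth_fun_at p f ->
  smooth_fun_at p h ->
  dirderiv p v (fun q => f q * h q) = dirderiv p v f * h p + f p * dirderiv p v h.
Proof.
move=> sf sh; rewrite /dirderiv.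
have := derive_fun_mul v (smooth_at_diff sf) (smooth_at_diff sh).
by rewrite /= !to_chartK //; exact: mem_chart_at.
Qed.

Lemma dirderiv_sum p v r (f : 'I_r -> M -> R) :
  (forall i, smooth_fun_at p (f i)) ->
  dirderiv p v (fun q => \sum_(i < r) f i q) = \sum_(i < r) dirderiv p v (f i).
Proof.
move=> sf; have := @derive_fun_sum R _ R^o r (fun i => f i \o of_chart (chart_at p))
  (loc p) v (fun i => smooth_at_diff (sf i)).
by [].
Qed.

Lemma field_rep_local p X Y : (\forall q \near p, X q = Y q) ->
  \forall x \near loc p, field_rep p X x = field_rep p Y x.
Proof.
move=> XY; apply: (@field_rep_near p (fun q x =>
  change_coord (chart_at q) (chart_at p) q (X q) =
  change_coord (chart_at q) (chart_at p) q (Y q))).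
by apply: filterS XY => q ->.
Qed.

Lemma smooth_field_local p X Y : (\forall q \near p, X q = Y q) ->
  smooth_field_at p X -> smooth_field_at p Y.
Proof. by move=> XY; apply: smooth_at_ext; exact: field_rep_local. Qed.

Lemma field_rep_sum p r (f : 'I_r -> M -> R) (X : 'I_r -> M -> 'rV[R]_n) :
  \forall x \near loc p, field_rep p (fun q => \sum_(i < r) f i q *: X i q) x =
    \sum_(i < r) f i (of_chart (chart_at p) x) *: field_rep p (X i) x.
Proof.
have := near_of_chart (mem_chart_at p) (near_dom (mem_chart_at p)).
apply: filterS => x [_ px]; rewrite /field_rep.
set q := of_chart (chart_at p) x.
by rewrite (linear_comb (change_coord_linear (mem_chart_at q) px)).
Qed.

Lemma smooth_field_sum p r (f : 'I_r -> M -> R) (X : 'I_r -> M -> 'rV[R]_n) :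
  (forall i, smooth_fun_at p (f i)) -> (forall i, smooth_field_at p (X i)) ->
  smooth_field_at p (fun q => \sum_(i < r) f i q *: X i q).
Proof.
move=> sf sX; apply/smooth_at_row => j.
apply: (@smooth_at_ext _ _ _ (fun x => \sum_(i < r)
  (f i (of_chart (chart_at p) x) : R^o) * (field_rep p (X i) x 0 j : R^o))).
  have := field_rep_sum p f X; apply: filterS => x ->.
  by rewrite summxE; apply: eq_bigr => i _; rewrite mxE.
apply: smooth_at_sum => i; apply: smooth_at_mul; first exact: sf.
by move: j; apply/smooth_at_row; exact: sX.
Qed.

Lemma smooth_field_scale p (f : M -> R) X : smooth_fun_at p f ->
  smooth_field_at p X -> smooth_field_at p (fun q => f q *: X q).
Proof.
move=> sf sX.
have := @smooth_field_sum p 1 (fun=> f) (fun=> X) (fun=> sf) (fun=> sX).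
by under eq_fun do rewrite big_ord1.
Qed.

Lemma smooth_field_add p X Y : smooth_field_at p X -> smooth_field_at p Y ->
  smooth_field_at p (fun q => X q + Y q).
Proof.
move=> sX sY; have := @smooth_field_sum p 2 (fun _ _ => 1)
  (fun i => if i == ord0 then X else Y) (fun=> smooth_fun_cst p 1).
have -> : (fun q : M => \sum_(i < 2) 1 *: (if i == ord0 then X else Y) q) =
    (fun q => X q + Y q).
  by apply/funext => q; rewrite !big_ord_recl big_ord0 !scale1r addr0.
by apply => i; case: ifP.
Qed.

Lemma field_rep_coord p i :
  \forall x \near loc p, field_rep p (coord_field p i) x = delta_mx 0 i.
Proof.
have := near_of_chart (mem_chart_at p) (near_dom (mem_chart_at p)).
apply: filterS => x [_ px]; rewrite /field_rep /coord_field change_coordK //.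
exact: mem_chart_at.
Qed.

Lemma coord_field_smooth p i : smooth_field_at p (coord_field p i).
Proof.
apply: smooth_at_ext (smooth_at_cst (delta_mx 0 i) _).
by have := field_rep_coord p i; apply: filterS => x ->.
Qed.

Lemma field_expansion p X : \forall q \near p,
  X q = \sum_i field_rep p X (to_chart (chart_at p) q) 0 i *: coord_field p i q.
Proof.
have := near_dom (mem_chart_at p); apply: filterS => q pq.
by rewrite /field_rep to_chartK //; exact: coord_field_expansion.
Qed.

Lemma field_component_smooth p X i : smooth_field_at p X ->
  smooth_fun_at p (fun q => field_rep p X (to_chart (chart_at p) q) 0 i).
Proof.
move=> /smooth_at_row /(_ i); apply: smooth_at_ext.
apply: filterS (near_cod (to_chart_cod (mem_chart_at p))) => x cx /=.
by rewrite of_chartK.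
Qed.

Lemma dirderiv_component p X v i : smooth_field_at p X ->
  dirderiv p v (fun q => field_rep p X (to_chart (chart_at p) q) 0 i) =
  ('D_v (field_rep p X) (loc p)) 0 i.
Proof.
move=> sX; rewrite derive_row; last exact: smooth_at_diff.
apply: near_eq_derive.
apply: filterS (near_cod (to_chart_cod (mem_chart_at p))) => x cx /=.
by rewrite of_chartK.
Qed.

(** Extends the vector [v] at [p], with constant components in one chart. *)
Definition const_field p v : M -> 'rV[R]_n :=
  fun q => \sum_i v 0 i *: coord_field p i q.

Lemma const_field_center p v : const_field p v p = v.
Proof.
rewrite /const_field [RHS]row_sum_delta.
by apply: eq_bigr => i _; rewrite coord_field_center.
Qed.

Lemma const_field_smooth p v : smooth_field_at p (const_field p v).
Proof.
apply: smooth_field_sum => i; [exact: smooth_fun_cst|exact: coord_field_smooth].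
Qed.

End change_of_coordinates.

(** * Connections in coordinates *)

Section connections.
Context {R : realType} {n : nat} {M : manifold R n}.
Implicit Types (p q : M) (v : 'rV[R]_n) (X Y : M -> 'rV[R]_n).
Implicit Type nb : connection M.

Notation loc p := (to_chart (chart_at p) p).

(** A connection is local although its arguments are globally defined: only
    smoothness near [p] is asked of the factor in Leibniz' rule, so that an
    indicator function may be used where one expects a bump function. *)
Lemma cov0 nb p v Y : (\forall q \near p, Y q = 0) -> nb p v Y = 0.
Proof.
move=> Y0.
(* [f] vanishes near [p], and [Y = f *: Y] everywhere. *)
pose f q : R := if `[< Y q = 0 >] then 0 else 1.
have f0 : \forall q \near p, 0 = f q.
  by apply: filterS Y0 => q Yq; rewrite /f asboolT.
have sf : smooth_fun_at p f by apply: smooth_fun_local f0 _; exact: smooth_fun_cst.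
have sY : smooth_field_at p Y.
  apply: (@smooth_field_local _ _ _ _ (fun=> 0)); first by apply: filterS Y0 => q ->.
  have := @smooth_field_sum _ _ _ p 0 (fun _ _ => 0) (fun _ _ => 0)
    (fun=> smooth_fun_cst p 0).
  under [X in (_ -> smooth_field_at p X) -> _]eq_fun do rewrite big_ord0.
  by apply; case.
have -> : Y = fun q => f q *: Y q.
  apply/funext => q; rewrite /f; case: asboolP => [->|_]; first by rewrite scaler0.
  by rewrite scale1r.
rewrite cov_leibniz // -(nbhs_singleton f0) scale0r addr0.
by rewrite -(dirderiv_local v f0) dirderiv_cst scale0r.
Qed.

Lemma cov_local nb p v X Y : (\forall q \near p, X q = Y q) ->
  smooth_field_at p X -> nb p v X = nb p v Y.
Proof.
move=> XY sX; have sY := smooth_field_local XY sX.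
pose Z q := Y q + (-1) *: X q.
have sZ : smooth_field_at p Z.
  exact: smooth_field_add sY (smooth_field_scale (smooth_fun_cst p (-1)) sX).
have Z0 : \forall q \near p, Z q = 0.
  by apply: filterS XY => q XYq; rewrite /Z XYq scaleN1r subrr.
have -> : Y = fun q => X q + Z q.
  by apply/funext => q; rewrite /Z scaleN1r addrC subrK.
by rewrite (cov_add nb v sX sZ) (cov0 _ _ Z0) addr0.
Qed.

Lemma cov_sum nb p v r (f : 'I_r -> M -> R) (X : 'I_r -> M -> 'rV[R]_n) :
  (forall i, smooth_fun_at p (f i)) -> (forall i, smooth_field_at p (X i)) ->
  nb p v (fun q => \sum_(i < r) f i q *: X i q) =
  \sum_(i < r) (dirderiv p v (f i) *: X i p + f i p *: nb p v (X i)).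
Proof.
elim: r f X => [|r IH] f X sf sX.
  by rewrite big_ord0; apply: cov0; apply: nearW => q; rewrite big_ord0.
have -> : (fun q => \sum_(i < r.+1) f i q *: X i q) = fun q =>
    f ord0 q *: X ord0 q + \sum_(i < r) f (lift ord0 i) q *: X (lift ord0 i) q.
  by apply/funext => q; rewrite big_ord_recl.
have sX' : smooth_field_at p (fun q => f ord0 q *: X ord0 q).
  exact: smooth_field_scale.
have sY : smooth_field_at p (fun q => \sum_(i < r)
    f (lift ord0 i) q *: X (lift ord0 i) q).
  exact: (smooth_field_sum (fun i => sf (lift ord0 i)) (fun i => sX (lift ord0 i))).
rewrite (cov_add nb v sX' sY) (cov_leibniz nb v (sf ord0) (sX ord0)).
rewrite [RHS]big_ord_recl; congr (_ + _).
exact: (IH (fun i => f (lift ord0 i)) (fun i => X (lift ord0 i))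
  (fun i => sf (lift ord0 i)) (fun i => sX (lift ord0 i))).
Qed.

Lemma covE nb p v Y : smooth_field_at p Y ->
  nb p v Y = 'D_v (field_rep p Y) (loc p) +
    \sum_i Y p 0 i *: nb p v (coord_field p i).
Proof.
move=> sY; apply: etrans (cov_local nb v (field_expansion p Y) sY) _.
apply: etrans (cov_sum nb v (fun i => field_component_smooth i sY)
  (@coord_field_smooth _ _ _ p)) _.
rewrite big_split /=; congr (_ + _); last first.
  by apply: eq_bigr => i _; rewrite field_rep_center.
rewrite [RHS]row_sum_delta; apply: eq_bigr => i _.
by rewrite coord_field_center (dirderiv_component v i sY).
Qed.

(** Coordinate fields commute, their components being constant. *)
Lemma torsion_free_coord nb p i j : torsion_free nb ->
  nb p (delta_mx 0 i) (coord_field p j) = nb p (delta_mx 0 j) (coord_field p i).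
Proof.
move=> tf; have e := tf p _ _ (coord_field_smooth p i) (coord_field_smooth p j).
have D0 k v : 'D_v (field_rep p (coord_field p k)) (loc p) = 0.
  have e0 := @derive_cst R 'rV[R]_n 'rV[R]_n (delta_mx 0 k) (loc p) v.
  rewrite -e0.
  exact: (@near_eq_derive _ _ _ _ (cst (delta_mx 0 k))  _ v (field_rep_coord p k)).
apply: subr0_eq.
rewrite !coord_field_center in e.
rewrite e /lie_bracket.
exact: etrans (congr2 (fun a b => a - b) (D0 j _) (D0 i _)) (subrr 0).
Qed.

End connections.

(** * Fields along an immersion *)

Section along.
Context {R : realType} {n m : nat} {M : manifold R n} {N : manifold R m}.
Variables (iota : M -> N) (imm : immersion iota).
Implicit Types (p q : M) (v : 'rV[R]_n) (V W : M -> 'rV[R]_m)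
  (X Y : M -> 'rV[R]_n) (nb : connection N).

Notation loc p := (to_chart (chart_at p) p).
Notation push := (pushforward iota).

Lemma near_iota p (P : N -> Prop) :
  (\forall r \near iota p, P r) -> \forall q \near p, P (iota q).
Proof. by move=> nP; have [ci _ _] := imm; exact: ci p _ nP. Qed.

Lemma near_charts p : \forall q \near p,
  dom (chart_at p) q /\ dom (chart_at (iota p)) (iota q).
Proof.
apply: filterI; first exact: near_dom (mem_chart_at p).
exact: near_iota (near_dom (mem_chart_at (iota p))).
Qed.

Lemma map_rep_smooth p : smooth_at (map_rep iota p) (loc p).
Proof. by have [_ si _] := imm. Qed.

Lemma map_rep_center p : map_rep iota p (loc p) = loc (iota p).
Proof. by rewrite /map_rep /= to_chartK //; exact: mem_chart_at. Qed.

Lemma map_rep_near p : \forall x \near loc p,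
  of_chart (chart_at (iota p)) (map_rep iota p x) = iota (of_chart (chart_at p) x).
Proof.
have := near_of_chart (mem_chart_at p) (near_charts p).
by apply: filterS => x [_ [_ ix]]; rewrite /map_rep /= to_chartK.
Qed.

Lemma push_linear p : linear (push p).
Proof. by apply: derive_linear; apply: smooth_at_diff; exact: map_rep_smooth. Qed.

Lemma push_inj p : injective (push p).
Proof. by have [_ _] := imm. Qed.

Lemma smooth_fun_restrict p (f : N -> R) : smooth_fun_at (iota p) f ->
  smooth_fun_at p (f \o iota).
Proof.
move=> sf; rewrite /smooth_fun_at -map_rep_center in sf.
apply: smooth_at_ext (smooth_at_comp (map_rep_smooth p) sf).
by have := map_rep_near p; apply: filterS => x /= ->.
Qed.

Lemma dirderiv_restrict p v (f : N -> R) : smooth_fun_at (iota p) f ->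
  dirderiv p v (f \o iota) = dirderiv (iota p) (push p v) f.
Proof.
move=> sf; rewrite /smooth_fun_at -map_rep_center in sf.
rewrite /dirderiv -map_rep_center.
have dF := smooth_at_diff (map_rep_smooth p).
apply: etrans _ (derive_comp v dF (smooth_at_diff sf)).
apply: near_eq_derive.
by have := map_rep_near p; apply: filterS => x /= ->.
Qed.

Lemma along_rep_center p V : along_rep iota p V (loc p) = V p.
Proof.
rewrite /along_rep to_chartK; last exact: mem_chart_at.
by rewrite change_coord_id //; exact: mem_chart_at.
Qed.

Lemma along_rep_local p V W : (\forall q \near p, V q = W q) ->
  \forall x \near loc p, along_rep iota p V x = along_rep iota p W x.
Proof.
move=> VW; have := near_of_chart (mem_chart_at p) VW.
by apply: filterS => x [_ e]; rewrite /along_rep e.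
Qed.

Lemma smooth_along_local p V W : (\forall q \near p, V q = W q) ->
  smooth_along_at iota p V -> smooth_along_at iota p W.
Proof. by move=> VW; apply: smooth_at_ext; exact: along_rep_local. Qed.

Lemma along_rep_sum p r (f : 'I_r -> M -> R) (V : 'I_r -> M -> 'rV[R]_m) :
  \forall x \near loc p,
    along_rep iota p (fun q => \sum_(i < r) f i q *: V i q) x =
    \sum_(i < r) f i (of_chart (chart_at p) x) *: along_rep iota p (V i) x.
Proof.
have := near_of_chart (mem_chart_at p) (near_charts p).
apply: filterS => x [_ [_ ix]]; rewrite /along_rep.
set q := of_chart (chart_at p) x.
by rewrite (linear_comb (change_coord_linear (mem_chart_at (iota q)) ix)).
Qed.

Lemma along_rep_sum_component p r (f : 'I_r -> M -> R)
    (V : 'I_r -> M -> 'rV[R]_m) j : \forall x \near loc p,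
  \sum_(i < r) (f i (of_chart (chart_at p) x) : R^o) *
      (along_rep iota p (V i) x 0 j : R^o) =
  along_rep iota p (fun q => \sum_(i < r) f i q *: V i q) x 0 j.
Proof.
have := along_rep_sum p f V; apply: filterS => x ->.
by rewrite summxE; apply: eq_bigr => i _; rewrite mxE.
Qed.

Lemma smooth_along_sum p r (f : 'I_r -> M -> R) (V : 'I_r -> M -> 'rV[R]_m) :
  (forall i, smooth_fun_at p (f i)) ->
  (forall i, smooth_along_at iota p (V i)) ->
  smooth_along_at iota p (fun q => \sum_(i < r) f i q *: V i q).
Proof.
move=> sf sV; apply/smooth_at_row => j.
apply: smooth_at_ext (along_rep_sum_component p f V j) _.
apply: smooth_at_sum => i; apply: smooth_at_mul; first exact: sf.
exact: (smooth_at_row _ _).1 (sV i) j.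
Qed.

Lemma smooth_along_scale p (f : M -> R) V : smooth_fun_at p f ->
  smooth_along_at iota p V -> smooth_along_at iota p (fun q => f q *: V q).
Proof.
move=> sf sV.
have := @smooth_along_sum p 1 (fun=> f) (fun=> V) (fun=> sf) (fun=> sV).
by under eq_fun do rewrite big_ord1.
Qed.

Lemma smooth_along_add p V W : smooth_along_at iota p V ->
  smooth_along_at iota p W -> smooth_along_at iota p (fun q => V q + W q).
Proof.
move=> sV sW; have := @smooth_along_sum p 2 (fun _ _ => 1)
  (fun i => if i == ord0 then V else W) (fun=> smooth_fun_cst p 1).
have -> : (fun q : M => \sum_(i < 2) 1 *: (if i == ord0 then V else W) q) =
    (fun q => V q + W q).
  by apply/funext => q; rewrite !big_ord_recl big_ord0 !scale1r addr0.
by apply => i; case: ifP.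
Qed.

Lemma along_rep_restrict p (E : N -> 'rV[R]_m) : \forall x \near loc p,
  field_rep (iota p) E (map_rep iota p x) = along_rep iota p (E \o iota) x.
Proof.
by have := map_rep_near p; apply: filterS => x e; rewrite /field_rep e.
Qed.

Lemma smooth_along_restrict p (E : N -> 'rV[R]_m) :
  smooth_field_at (iota p) E -> smooth_along_at iota p (E \o iota).
Proof.
move=> sE; apply/smooth_at_row => j.
have sEj := (smooth_at_row _ _).1 sE j; rewrite -map_rep_center in sEj.
apply: smooth_at_ext (smooth_at_comp (map_rep_smooth p) sEj).
by have := along_rep_restrict p E; apply: filterS => x /= ->.
Qed.

Lemma along_expansion p V : \forall q \near p, V q =
  \sum_i along_rep iota p V (to_chart (chart_at p) q) 0 i *:
    (coord_field (iota p) i \o iota) q.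
Proof.
have := near_charts p; apply: filterS => q [pq iq].
by rewrite /along_rep to_chartK //; exact: coord_field_expansion.
Qed.

Lemma along_component_smooth p V i : smooth_along_at iota p V ->
  smooth_fun_at p (fun q => along_rep iota p V (to_chart (chart_at p) q) 0 i).
Proof.
move=> /smooth_at_row /(_ i); apply: smooth_at_ext.
apply: filterS (near_cod (to_chart_cod (mem_chart_at p))) => x cx /=.
by rewrite of_chartK.
Qed.

(** The transition maps of both manifolds cancel out of the chain rule for
    one and the same local map, read in the charts at [q] and at [p]. *)
Lemma push_change_coord p q u : dom (chart_at p) q ->
  dom (chart_at (iota p)) (iota q) ->
  differentiable (map_rep iota p) (to_chart (chart_at p) q) ->
  change_coord (chart_at (iota q)) (chart_at (iota p)) (iota q) (push q u) =
  'D_(change_coord (chart_at q) (chart_at p) q u) (map_rep iota p)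
    (to_chart (chart_at p) q).
Proof.
move=> pq iq dp; have qq := mem_chart_at q; have iqq := mem_chart_at (iota q).
have dq := smooth_at_diff (map_rep_smooth q).
have dt := transition_diff qq pq.
have di := transition_diff iqq iq.
rewrite -map_rep_center in di.
have et : (to_chart (chart_at p) \o of_chart (chart_at q)) (loc q) =
    to_chart (chart_at p) q by rewrite /= to_chartK.
rewrite -et in dp.
rewrite {1}/change_coord -map_rep_center -et.
refine (etrans (esym (derive_comp u dq di)) _).
refine (etrans _ (derive_comp u dt dp)).
apply: near_eq_derive.
have := near_and (near_of_chart qq (near_dom pq)) (near_of_chart qq (near_charts q)).
apply: filterS => x [[_ px] [_ [_ ix]]] /=.
by rewrite /map_rep /= !to_chartK.
Qed.

(** The charts at the points near [p], in which fields take their values, drop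
    out: fields are pushed forward by the differential of one local map. *)
Lemma along_rep_push p Y : \forall x \near loc p,
  'D_(field_rep p Y x) (map_rep iota p) x =
  along_rep iota p (fun q => push q (Y q)) x.
Proof.
have sm := smooth_at_near (map_rep_smooth p).
have := near_and sm (near_of_chart (mem_chart_at p) (near_charts p)).
apply: filterS => x [sx [cx [px ix]]].
have := @push_change_coord p (of_chart (chart_at p) x)
  (Y (of_chart (chart_at p) x)) px ix.
rewrite (of_chartK cx) => /(_ (smooth_at_diff sx)) e.
exact: esym e.
Qed.

Lemma along_rep_push_component p Y : \forall x \near loc p,
  forall i, \sum_j (field_rep p Y x 0 j : R^o) *
    ('D_(delta_mx 0 j) (map_rep iota p) x 0 i : R^o) =
  along_rep iota p (fun q => push q (Y q)) x 0 i.
Proof.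
have sm := smooth_at_near (map_rep_smooth p).
have := near_and sm (along_rep_push p Y).
apply: filterS => x [sx <-] i.
rewrite (derive_sum_dir _ (smooth_at_diff sx)) summxE.
by apply: eq_bigr => j _; rewrite mxE.
Qed.

Lemma smooth_along_push p Y : smooth_field_at p Y ->
  smooth_along_at iota p (fun q => push q (Y q)).
Proof.
move=> sY; apply/smooth_at_row => i.
apply: (smooth_at_ext (f := fun x => \sum_j (field_rep p Y x 0 j : R^o) *
    ('D_(delta_mx 0 j) (map_rep iota p) x 0 i : R^o))).
  by have := along_rep_push_component p Y; apply: filterS => x.
apply: smooth_at_sum => j; apply: smooth_at_mul.
  exact: (smooth_at_row _ _).1 sY j.
exact: (smooth_at_row _ _).1 (smooth_at_derive _ (map_rep_smooth p)) i.
Qed.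

Lemma cov_along_local nb p v V W : (\forall q \near p, V q = W q) ->
  cov_along iota nb p v V = cov_along iota nb p v W.
Proof.
move=> VW; have e1 := near_eq_derive v (along_rep_local VW).
by have e2 : V p = W p := nbhs_singleton VW; rewrite /cov_along e1 e2.
Qed.

(** Additivity and Leibniz' rule in one statement, since every field along the
    immersion is such a combination of restricted coordinate fields. *)
Lemma cov_along_sum nb p v r (f : 'I_r -> M -> R) (V : 'I_r -> M -> 'rV[R]_m) :
  (forall i, smooth_fun_at p (f i)) ->
  (forall i, smooth_along_at iota p (V i)) ->
  cov_along iota nb p v (fun q => \sum_(i < r) f i q *: V i q) =
  \sum_(i < r) (dirderiv p v (f i) *: V i p
    + f i p *: cov_along iota nb p v (V i)).
Proof.
move=> sf sV; have sS := smooth_along_sum sf sV.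
have -> : cov_along iota nb p v (fun q => \sum_(i < r) f i q *: V i q) =
    \sum_(i < r) (dirderiv p v (f i) *: V i p +
       f i p *: 'D_v (along_rep iota p (V i)) (loc p)) +
    \sum_j \sum_(i < r) (f i p * V i p 0 j) *:
      nb (iota p) (push p v) (coord_field (iota p) j).
  congr (_ + _); last first.
    apply: eq_bigr => j _; rewrite -scaler_suml; congr (_ *: _).
    by rewrite summxE; apply: eq_bigr => i _; rewrite mxE.
  apply/rowP => j; rewrite (derive_row _ _ (smooth_at_diff sS)).
  rewrite -(near_eq_derive _ (along_rep_sum_component p f V j)) summxE.
  have dV i := (differentiable_rowP _ _).1 (smooth_at_diff (sV i)) j.
  have df i := smooth_at_diff (sf i).
  have dfV i := differentiable_fun_mul (df i) (dV i).
  apply: etrans (derive_fun_sum v dfV) _; apply: eq_bigr => i _.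
  apply: etrans (derive_fun_mul v (df i) (dV i)) _.
  rewrite !mxE -(derive_row _ _ (smooth_at_diff (sV i))) along_rep_center.
  by rewrite /dirderiv /= to_chartK //; exact: mem_chart_at.
rewrite exchange_big /= -big_split /=; apply: eq_bigr => i _.
rewrite -[LHS]addrA; congr (_ + _).
apply: etrans _ (esym (scalerDr _ _ _)); congr (_ + _).
by rewrite [RHS]scaler_sumr; apply: eq_bigr => j _; rewrite scalerA.
Qed.

Lemma cov_along_restrict nb p v (E : N -> 'rV[R]_m) :
  smooth_field_at (iota p) E ->
  cov_along iota nb p v (E \o iota) = nb (iota p) (push p v) E.
Proof.
move=> sE; apply: etrans _ (esym (covE nb (push p v) sE)).
have e1 := near_eq_derive v (along_rep_restrict p E).
have dE := smooth_at_diff sE; rewrite -map_rep_center in dE.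
have e2 := derive_comp v (smooth_at_diff (map_rep_smooth p)) dE.
rewrite map_rep_center in e2.
have e : 'D_v (along_rep iota p (E \o iota)) (loc p) =
    'D_(push p v) (field_rep (iota p) E) (loc (iota p)) :> 'rV[R]_m.
  refine (etrans (esym e1) e2).
rewrite -e; reflexivity.
Qed.

Lemma cov_along_frame nb p v r (f : 'I_r -> M -> R) (E : 'I_r -> N -> 'rV[R]_m) :
  (forall i, smooth_fun_at p (f i)) -> (forall i, smooth_field_at (iota p) (E i)) ->
  cov_along iota nb p v (fun q => \sum_(i < r) f i q *: E i (iota q)) =
  \sum_(i < r) (dirderiv p v (f i) *: E i (iota p)
    + f i p *: nb (iota p) (push p v) (E i)).
Proof.
move=> sf sE.
have sEr i := smooth_along_restrict (sE i).
refine (etrans (cov_along_sum nb v sf sEr) _).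
by apply: eq_bigr => i _; rewrite (cov_along_restrict nb v (sE i)).
Qed.

(** Reduces statements on fields along the immersion to the coordinate fields of
    the ambient chart at [iota p]. *)
Lemma along_frame p V : smooth_along_at iota p V ->
  exists2 f : 'I_m -> M -> R, (forall i, smooth_fun_at p (f i)) &
    \forall q \near p, V q = \sum_i f i q *: coord_field (iota p) i (iota q).
Proof.
move=> sV.
exists (fun i q => along_rep iota p V (to_chart (chart_at p) q) 0 i).
  by move=> i; exact: along_component_smooth.
exact: along_expansion.
Qed.

End along.

(** * Duality and torsion along an immersion *)

Section metric_algebra.
Context {R : realType} {n : nat} {M : manifold R n}.
Variable g : riemannian_metric M.
Implicit Types (p : M) (u v w : 'rV[R]_n).

Lemma metric_linearr p u : linear (g p u : 'rV[R]_n -> R^o).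
Proof. exact: metric_linear. Qed.

Lemma metric_linearl p w : linear (fun u => g p u w : R^o).
Proof. by move=> a u v; rewrite !(metric_sym g p _ w) metric_linearr. Qed.

Definition metricDr p u v w : g p u (v + w) = g p u v + g p u w :=
  linear_funD (@metric_linearr p u) v w.
Definition metricNr p u v : g p u (- v) = - g p u v :=
  linear_funN (@metric_linearr p u) v.
Definition metricZr p u a v : g p u (a *: v) = a * g p u v :=
  linear_funZ (@metric_linearr p u) a v.
Definition metric0l p u : g p 0 u = 0 := linear_fun0 (@metric_linearl p u).
Definition metricDl p u v w : g p (v + w) u = g p v u + g p w u :=
  linear_funD (@metric_linearl p u) v w.
Definition metricBl p u v w : g p (v - w) u = g p v u - g p w u :=
  linear_funB (@metric_linearl p u) v w.
Definition metricZl p u a v : g p (a *: v) u = a * g p v u :=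
  linear_funZ (@metric_linearl p u) a v.

Lemma metric_sumr p u (I : Type) (r : seq I) (a : I -> R) (w : I -> 'rV[R]_n) :
  g p u (\sum_(i <- r) a i *: w i) = \sum_(i <- r) a i * g p u (w i).
Proof. exact: (linear_comb (@metric_linearr p u)). Qed.

Lemma metric_suml p u (I : Type) (r : seq I) (a : I -> R) (w : I -> 'rV[R]_n) :
  g p (\sum_(i <- r) a i *: w i) u = \sum_(i <- r) a i * g p (w i) u.
Proof. exact: (linear_comb (@metric_linearl p u)). Qed.

Lemma metric_definite p v : g p v v = 0 -> v = 0.
Proof.
move=> gv; case: (eqVneq v 0) => // v0.
by have := metric_pos g p v0; rewrite gv ltxx.
Qed.

Lemma metric_nondegenerate p u v : (forall w, g p u w = g p v w) -> u = v.
Proof.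
move=> e; apply: subr0_eq; apply: metric_definite (p) _ _.
by rewrite metricBl e subrr.
Qed.

End metric_algebra.

Section along_geometry.
Context {R : realType} {n m : nat} {M : manifold R n} {N : manifold R m}.
Variables (iota : M -> N) (imm : immersion iota) (g : riemannian_metric N).
Implicit Types (p q : M) (v : 'rV[R]_n) (V W : M -> 'rV[R]_m)
  (X Y Z : M -> 'rV[R]_n) (nb nbs : connection N).

Notation loc p := (to_chart (chart_at p) p).
Notation push := (pushforward iota).

Lemma metric_frame p (f h : 'I_m -> M -> R) V W :
  (\forall q \near p, V q = \sum_i f i q *: coord_field (iota p) i (iota q)) ->
  (\forall q \near p, W q = \sum_i h i q *: coord_field (iota p) i (iota q)) ->
  \forall q \near p, \sum_i \sum_j f i q * h j q *
    g (iota q) (coord_field (iota p) i (iota q)) (coord_field (iota p) j (iota q))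
   = g (iota q) (V q) (W q).
Proof.
move=> eV eW; have := near_and eV eW; apply: filterS => q [-> ->].
rewrite metric_suml; apply: eq_bigr => i _.
rewrite metric_sumr mulr_sumr; apply: eq_bigr => j _.
by rewrite mulrA.
Qed.

Lemma metric_coord_smooth p i j :
  smooth_fun_at p (fun q => g (iota q)
    (coord_field (iota p) i (iota q)) (coord_field (iota p) j (iota q))).
Proof.
have := metric_smooth g (coord_field_smooth (iota p) i) (coord_field_smooth (iota p) j).
exact: smooth_fun_restrict.
Qed.

Lemma metric_along_smooth p V W : smooth_along_at iota p V ->
  smooth_along_at iota p W ->
  smooth_fun_at p (fun q => g (iota q) (V q) (W q)).
Proof.
move=> /(along_frame imm)[f sf eV] /(along_frame imm)[h sh eW].
apply: smooth_fun_local (metric_frame eV eW) _.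
apply: smooth_fun_sum => i; apply: smooth_fun_sum => j.
apply: smooth_fun_mul; last exact: metric_coord_smooth.
exact: smooth_fun_mul.
Qed.

(** Both sides obey Leibniz' rule in [V] and in [W], which leaves the case of
    coordinate fields, where duality on the ambient manifold applies. *)
Lemma dual_along nb nbs p v V W : dual_connections g nb nbs ->
  smooth_along_at iota p V -> smooth_along_at iota p W ->
  dirderiv p v (fun q => g (iota q) (V q) (W q)) =
    g (iota p) (cov_along iota nb p v V) (W p) +
    g (iota p) (V p) (cov_along iota nbs p v W).
Proof.
move=> dual /(along_frame imm)[f sf eV] /(along_frame imm)[h sh eW].
pose d := coord_field (iota p).
have sd i : smooth_field_at (iota p) (d i) := coord_field_smooth (iota p) i.
rewrite -(dirderiv_local v (metric_frame eV eW)).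
have sg := metric_coord_smooth p.
have sfh i j := smooth_fun_mul (sf i) (sh j).
have sfhg i j := smooth_fun_mul (sfh i j) (sg i j).
rewrite (dirderiv_sum v (fun i => smooth_fun_sum _ _ (sfhg i))).
rewrite (cov_along_local iota nb v eV) (cov_along_local iota nbs v eW).
rewrite (cov_along_frame imm nb v sf sd) (cov_along_frame imm nbs v sh sd).
rewrite (nbhs_singleton eV) (nbhs_singleton eW).
pose w := push p v.
have gd i j : dirderiv p v (fun q => g (iota q) (d i (iota q)) (d j (iota q))) =
    g (iota p) (nb (iota p) w (d i)) (d j (iota p)) +
    g (iota p) (d i (iota p)) (nbs (iota p) w (d j)).
  have := @dual (iota p) (const_field (iota p) w) (d i) (d j)
    (const_field_smooth _ _) (sd i) (sd j).
  rewrite const_field_center => <-.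
  exact: (dirderiv_restrict imm v (metric_smooth g (sd i) (sd j))).
have Vsum u : g (iota p) (\sum_i (dirderiv p v (f i) *: d i (iota p) +
      f i p *: nb (iota p) w (d i))) u =
    \sum_i (dirderiv p v (f i) * g (iota p) (d i (iota p)) u
      + f i p * g (iota p) (nb (iota p) w (d i)) u).
  by rewrite big_split metricDl !metric_suml -big_split.
have Wsum u : g (iota p) u (\sum_i (dirderiv p v (h i) *: d i (iota p) +
      h i p *: nbs (iota p) w (d i))) =
    \sum_i (dirderiv p v (h i) * g (iota p) u (d i (iota p))
      + h i p * g (iota p) u (nbs (iota p) w (d i))).
  by rewrite big_split metricDr !metric_sumr -big_split.
rewrite Vsum metric_suml -big_split; apply: eq_bigr => i _.
rewrite Wsum (dirderiv_sum v (sfhg i)).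
rewrite !metric_sumr !mulr_sumr -!big_split.
apply: eq_bigr => j _.
rewrite (dirderiv_mul v (sfh i j) (sg i j)) (dirderiv_mul v (sf i) (sh j)) gd.
rewrite -/d -/w /=.
ring.
Qed.

(** The product rule for the matrix of first derivatives of the immersion,
    applied to the components of [Y]; symmetry of second derivatives allows the
    derivative along [v] to come first in the last term. *)
Lemma derive_along_push p v Y : smooth_field_at p Y ->
  'D_v (along_rep iota p (fun q => push q (Y q))) (loc p) =
  push p ('D_v (field_rep p Y) (loc p)) +
  'D_(Y p) ('D_v (map_rep iota p)) (loc p) :> 'rV[R]_m.
Proof.
move=> sY; have sF := map_rep_smooth imm p.
have dF := smooth_at_diff sF; have dY := smooth_at_diff sY.
have dDF w := smooth_at_diff (smooth_at_derive w sF).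
have dP := smooth_at_diff (smooth_along_push imm sY).
apply/rowP => i.
refine (etrans (derive_row _ _ dP) _).
have e0 : \forall x \near loc p,
    along_rep iota p (fun q => push q (Y q)) x 0 i =
    \sum_j (field_rep p Y x 0 j : R^o) *
      ('D_(delta_mx 0 j) (map_rep iota p) x 0 i : R^o).
  by have := along_rep_push_component imm p Y; apply: filterS => x e; rewrite e.
refine (etrans (near_eq_derive _ e0) _).
have dYj j := (differentiable_rowP _ _).1 dY j.
have dDFj j := (differentiable_rowP _ _).1 (dDF (delta_mx 0 j)) i.
refine (etrans (derive_fun_sum v (fun j => differentiable_fun_mul (dYj j) (dDFj j))) _).
have e1 := derive_sum_dir ('D_v (field_rep p Y) (loc p)) dF.
have e2 := derive_sum_dir (Y p) (dDF v).
rewrite mxE {1}/pushforward e1 e2 !summxE -big_split.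
apply: eq_bigr => j _.
refine (etrans (derive_fun_mul v (dYj j) (dDFj j)) _).
rewrite !mxE; congr (_ * _ + _ * _).
- by rewrite derive_row.
- by rewrite field_rep_center.
- by rewrite -(derive_row _ _ (dDF _)) (smooth_at_swap _ _ sF).
Qed.

(** Absence of torsion is the symmetry of the Christoffel symbols. *)
Lemma christoffel_symmetric nb (r : N) (a b : 'rV[R]_m) : torsion_free nb ->
  \sum_i a 0 i *: nb r b (coord_field r i) =
  \sum_i b 0 i *: nb r a (coord_field r i).
Proof.
move=> tf.
have cl (c : 'rV[R]_m) i : nb r c (coord_field r i) =
    \sum_j c 0 j *: nb r (delta_mx 0 j) (coord_field r i).
  rewrite {1}[c]row_sum_delta.
  exact: (linear_comb (cov_linear nb (coord_field_smooth r i))).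
under eq_bigr do rewrite cl scaler_sumr.
under [RHS]eq_bigr do rewrite cl scaler_sumr.
rewrite [RHS]exchange_big; apply: eq_bigr => i _; apply: eq_bigr => j _.
by rewrite !scalerA mulrC (torsion_free_coord _ _ _ tf).
Qed.

(** The difference is the push-forward of the bracket of the fields: the second
    derivatives of the immersion and the connection coefficients cancel by
    symmetry.  Its tangency is the symmetry of the second fundamental form. *)
Lemma torsion_along nb p Y Z : torsion_free nb ->
  smooth_field_at p Y -> smooth_field_at p Z ->
  exists u, cov_along iota nb p (Z p) (fun q => push q (Y q)) =
    cov_along iota nb p (Y p) (fun q => push q (Z q)) + push p u.
Proof.
move=> tf sY sZ.
exists ('D_(Z p) (field_rep p Y) (loc p) - 'D_(Y p) (field_rep p Z) (loc p)).
rewrite (linear_funB (push_linear imm p)) /cov_along.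
have e1 := derive_along_push (Z p) sY; have e2 := derive_along_push (Y p) sZ.
have e3 := smooth_at_swap (Y p) (Z p) (map_rep_smooth imm p).
have e4 := christoffel_symmetric (iota p) (push p (Y p)) (push p (Z p)) tf.
have add_cancel (a b c c' d d' s s' : 'rV[R]_m) :
    a = c + d -> b = c' + d' -> d = d' -> s = s' ->
    a + s = b + s' + (c - c').
  move=> -> -> -> ->; rewrite [RHS]addrC -!addrA; congr (c + _).
  by rewrite addKr.
exact (add_cancel _ _ _ _ _ _ _ _ e1 e2 e3 e4).
Qed.

End along_geometry.

(** * Dual connections and the Sasakian structure *)

Section dual_pairs.
Context {R : realType} {m : nat} {N : manifold R m}.
Variable g : riemannian_metric N.
Implicit Types (p : N) (v : 'rV[R]_m) (X Y Z : N -> 'rV[R]_m).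
Implicit Types nb nbs lc : connection N.

Lemma dual_connections_sym nb nbs :
  dual_connections g nb nbs -> dual_connections g nbs nb.
Proof.
move=> dual p X Y Z sX sY sZ; rewrite addrC.
rewrite (metric_sym g p _ (nb p (X p) Z)) (metric_sym g p (nbs p (X p) Y)).
rewrite -dual //; apply: dirderiv_local; apply: nearW => q.
exact: metric_sym.
Qed.

(** By duality, the skew part in [X], [Y] of [g(nbs_X Y, Z)] is expressed through
    the derivatives of [g(Y, Z)] and [g(X, Z)] and through [nb], and Codazzi's
    equation identifies it with that of [g(nb_X Y, Z)]. *)
Lemma dual_torsion_free nb nbs : statistical_structure g nb ->
  dual_connections g nb nbs -> torsion_free nbs.
Proof.
move=> [tf codazzi] dual p X Y sX sY; apply: (@metric_nondegenerate _ _ _ g p).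
move=> w; rewrite -(const_field_center p w); set Z := const_field p w.
have sZ : smooth_field_at p Z := const_field_smooth p w.
have e1 := codazzi p X Y Z sX sY sZ; rewrite /cov_metric in e1.
have sym U1 U2 U3 : dirderiv p (U1 p) (fun q => g q (U2 q) (U3 q)) =
    dirderiv p (U1 p) (fun q => g q (U3 q) (U2 q)).
  by apply: dirderiv_local; apply: nearW => q; exact: metric_sym.
have e2 := dual p X Z Y sX sZ sY; have e3 := dual p Y Z X sY sZ sX.
rewrite (sym X Y Z) e2 (sym Y X Z) e3 in e1.
rewrite -(tf p X Y sX sY) !metricBl; move: e1.
rewrite (metric_sym g p (nb p (X p) Z)) (metric_sym g p (nb p (Y p) Z)).
rewrite (metric_sym g p (Z p) (nbs p (X p) Y)) (metric_sym g p (Z p) (nbs p (Y p) X)).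
have alg (a b c d s t : R) : a + c - s - a = b + d - t - b -> c - d = s - t by lra.
exact: alg.
Qed.

(** A trilinear form that is symmetric in its first two arguments and skew in
    its last two vanishes: this is Koszul's argument for the uniqueness of the
    Levi-Civita connection, applied to the mean of the dual connections. *)
Lemma dual_connections_mean nb nbs lc p v Y :
  levi_civita g lc -> torsion_free nb -> torsion_free nbs ->
  dual_connections g nb nbs -> smooth_field_at p Y ->
  nb p v Y + nbs p v Y = lc p v Y + lc p v Y.
Proof.
move=> [tfl metl] tf tfs dual sY.
pose T (X Y Z : N -> 'rV[R]_m) := g p (nb p (X p) Y + nbs p (X p) Y
  - (lc p (X p) Y + lc p (X p) Y)) (Z p).
pose smooth X := smooth_field_at p X.
have Tsym X1 X2 X3 : smooth X1 -> smooth X2 -> T X1 X2 X3 = T X2 X1 X3.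
  move=> s1 s2; have e1 := tf p X1 X2 s1 s2; have e2 := tfs p X1 X2 s1 s2.
  have e3 := tfl p X1 X2 s1 s2; rewrite /T; congr (g p _ _).
  move: e1 e2 e3 => /(canRL (subrK _)) -> /(canRL (subrK _)) ->.
  move=> /(canRL (subrK _)) ->.
  have alg (b c d e : 'rV[R]_m) :
      b + c + (b + d) - (b + e + (b + e)) = c + d - (e + e).
    by apply/rowP => i; rewrite !mxE; ring.
  exact (alg _ _ _ _).
have Tskew X1 X2 X3 : smooth X1 -> smooth X2 -> smooth X3 ->
    T X1 X2 X3 = - T X1 X3 X2.
  move=> s1 s2 s3; have e1 := dual p X1 X2 X3 s1 s2 s3.
  have e2 := dual_connections_sym dual s1 s2 s3.
  have e3 := metl p X1 X2 X3 s1 s2 s3; rewrite /cov_metric in e3.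
  rewrite /T !(metricBl, metricDl).
  rewrite (metric_sym g p (nb p (X1 p) X3)) (metric_sym g p (nbs p (X1 p) X3)).
  rewrite (metric_sym g p (lc p (X1 p) X3)).
  move: e1 e2 e3; set D := dirderiv _ _ _.
  have alg (d a b c e s t : R) : d = a + b -> d = c + e -> d - s - t = 0 ->
    a + c - (s + s) = - (e + b - (t + t)) by lra.
  move=> e1 e2 e3; exact: (alg _ _ _ _ _ _ _ e1 e2 e3).
apply: subr0_eq; apply: (@metric_nondegenerate _ _ _ g p) => w.
rewrite metric0l -(const_field_center p w) -(const_field_center p v).
set Z := const_field p w; set X := const_field p v.
have sX : smooth X := const_field_smooth p v.
have sZ : smooth Z := const_field_smooth p w.
have e1 := Tsym X Y Z sX sY; have e2 := Tskew Y X Z sY sX sZ.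
have e3 := Tsym Y Z X sY sZ; have e4 := Tskew Z Y X sZ sY sX.
have e5 := Tsym Z X Y sZ sX; have e6 := Tskew X Z Y sX sZ sY.
rewrite -[LHS]/(T X Y Z); lra.
Qed.

Variables (phi : endo_field N) (xi : N -> 'rV[R]_m) (eta : one_form N).

Definition sasaki_identity nb nbs := forall p v Y, smooth_field_at p Y ->
  nb p v (fun q => phi q (Y q)) - phi p (nbs p v Y) =
  g p (Y p) (xi p) *: v - g p (Y p) v *: xi p.

(** With [nb = lc + K] and [nbs = lc - K], the two left-hand sides are
    [(lc_v phi) Y] plus and minus [K(v, phi Y) + phi K(v, Y)], which vanishes. *)
Lemma sasaki_identities nb nbs lc :
  sasakian_statistical g phi xi eta nb lc -> dual_connections g nb nbs ->
  sasaki_identity nb nbs /\ sasaki_identity nbs nb.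
Proof.
move=> sas dual; have stat := sas_statistical sas.
have tf := stat.1; have tfs := dual_torsion_free stat dual.
have lin p := endo_linear phi p.
suff both p v Y : smooth_field_at p Y ->
    nb p v (fun q => phi q (Y q)) - phi p (nbs p v Y) =
      g p (Y p) (xi p) *: v - g p (Y p) v *: xi p /\
    nbs p v (fun q => phi q (Y q)) - phi p (nb p v Y) =
      g p (Y p) (xi p) *: v - g p (Y p) v *: xi p.
  by split=> p v Y sY; have [] := both p v Y sY.
move=> sY; have sphiY := endo_smooth phi sY.
have sX := const_field_smooth p v.
have e1 := sas_phi sas sX sY; have e2 := sas_K sas sX sY.
rewrite /difference_tensor const_field_center in e1 e2; rewrite -e1.
have m1 := dual_connections_mean v (sas_levi_civita sas) tf tfs dual sY.
have m2 := dual_connections_mean v (sas_levi_civita sas) tf tfs dual sphiY.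
have {}m1 : nbs p v Y = lc p v Y + lc p v Y - nb p v Y.
  by rewrite -m1 addrC addKr.
have {}m2 : nbs p v (fun q => phi q (Y q)) = lc p v (fun q => phi q (Y q))
    + lc p v (fun q => phi q (Y q)) - nb p v (fun q => phi q (Y q)).
  by rewrite -m2 addrC addKr.
rewrite m1 m2 !(linear_funB (lin p), linear_funD (lin p)).
rewrite (linear_funB (lin p)) in e2.
have alg (a b c d : 'rV[R]_m) : a - b + (c - d) = 0 ->
    a - (d + d - c) = b - d /\ b + b - a - c = b - d.
  move=> /rowP e; split; apply/rowP => i; move: (e i); rewrite !mxE; lra.
exact (alg _ _ _ _ e2).
Qed.

Hypothesis acm : almost_contact_metric g phi xi eta.

Lemma eta_xi p : eta p (xi p) = 1.
Proof. by rewrite -(acm_eta acm) (acm_xi_unit acm). Qed.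

Lemma phi_xi p : phi p (xi p) = 0.
Proof.
apply: (@metric_definite _ _ _ g p).
by rewrite (acm_metric acm) eta_xi (acm_xi_unit acm) mulr1 subrr.
Qed.

Lemma eta_phi p v : eta p (phi p v) = 0.
Proof.
have lin := endo_linear phi p.
have := acm_phi2 acm p (phi p v).
rewrite {1}(acm_phi2 acm p v) (linear_funD lin) (linear_funN lin).
rewrite (linear_funZ lin) phi_xi scaler0 => /addrI /esym e.
have := acm_xi_unit acm p; rewrite -[LHS]mul1r.
move: e => /(congr1 (fun w => g p w (xi p))).
by rewrite metricZl metric0l (acm_xi_unit acm) mulr1.
Qed.

Lemma phi_skew p u v : g p (phi p u) v = - g p u (phi p v).
Proof.
have := acm_metric acm p u (phi p v).
rewrite eta_phi mulr0 subr0 (acm_phi2 acm p v) metricDr metricNr metricZr.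
by rewrite (acm_eta acm) eta_phi mulr0 addr0 => <-; rewrite opprK.
Qed.

(** As [phi xi = 0], the Sasakian identity for [xi] reads
    [phi (nb_v xi) = phi (phi v)], and the kernel of [phi] is spanned by [xi]. *)
Lemma cov_xi nb nbs p v : sasaki_identity nbs nb ->
  exists a, nb p v xi = phi p v + a *: xi p.
Proof.
move=> sas; have lin := endo_linear phi p.
have := sas p v xi (acm_xi_smooth acm p).
have -> : nbs p v (fun q => phi q (xi q)) = 0.
  by apply: cov0; apply: nearW => q; exact: phi_xi.
rewrite sub0r (acm_xi_unit acm) scale1r (metric_sym g) (acm_eta acm) => e.
have e1 : phi p (nb p v xi) = phi p (phi p v).
  by apply: oppr_inj; rewrite e (acm_phi2 acm) opprD opprK.
have := congr1 (phi p) e1.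
rewrite (acm_phi2 acm) [phi p (phi p (phi p v))](acm_phi2 acm) eta_phi scale0r addr0.
move=> e2; exists (eta p (nb p v xi)).
by apply: oppr_inj; rewrite opprD -e2 addrK.
Qed.

End dual_pairs.

Section sasaki_along.
Context {R : realType} {n m : nat} {M : manifold R n} {N : manifold R m}.
Variables (iota : M -> N) (imm : immersion iota) (g : riemannian_metric N).
Variables (phi : endo_field N) (xi : N -> 'rV[R]_m).

(** The derivatives of the coefficients of [V] cancel, so that the difference of
    the two sides is linear in [V] over functions: coordinate fields suffice. *)
Lemma sasaki_along nb nbs p v (V : M -> 'rV[R]_m) :
  sasaki_identity g phi xi nb nbs -> smooth_along_at iota p V ->
  cov_along iota nb p v (fun q => phi (iota q) (V q)) =
    phi (iota p) (cov_along iota nbs p v V) +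
    (g (iota p) (V p) (xi (iota p)) *: pushforward iota p v
     - g (iota p) (V p) (pushforward iota p v) *: xi (iota p)).
Proof.
move=> sas /(along_frame imm)[f sf eV].
pose d := coord_field (iota p).
have sd i : smooth_field_at (iota p) (d i) := coord_field_smooth (iota p) i.
have lin r := endo_linear phi r.
have ephiV : \forall q \near p, phi (iota q) (V q) =
    \sum_i f i q *: phi (iota q) (d i (iota q)).
  by apply: filterS eV => q ->; rewrite (linear_comb (lin _)).
rewrite (cov_along_local iota nb v ephiV) (cov_along_local iota nbs v eV).
rewrite (cov_along_frame imm nbs v sf sd).
have -> := cov_along_frame imm nb v sf (fun i => endo_smooth phi (sd i)).
rewrite (nbhs_singleton eV) !metric_suml !scaler_suml -sumrB.
have -> : phi (iota p) (\sum_i (dirderiv p v (f i) *: d i (iota p) +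
      f i p *: nbs (iota p) (pushforward iota p v) (d i))) =
    \sum_i (dirderiv p v (f i) *: phi (iota p) (d i (iota p)) +
      f i p *: phi (iota p) (nbs (iota p) (pushforward iota p v) (d i))).
  by rewrite !big_split (linear_funD (lin _)) !(linear_comb (lin _)).
rewrite -big_split; apply: eq_bigr => i _.
have e := sas (iota p) (pushforward iota p v) (d i) (sd i).
rewrite /= -!scalerA -scalerBr -e -addrA -scalerDr; congr (_ + _ *: _).
by rewrite addrC subrK.
Qed.

End sasaki_along.

(** * Orthogonal extensions of vectors to fields *)

Lemma smooth_fun_det {R : realType} {n : nat} {M : manifold R n} (p : M) r
    (A : M -> 'M[R]_r) : (forall i j, smooth_fun_at p (fun q => A q i j)) ->
  smooth_fun_at p (fun q => \det (A q)).
Proof.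
move=> sA; apply: smooth_fun_sum => s; apply: smooth_fun_mul.
  exact: smooth_fun_cst.
by apply: smooth_fun_prod.
Qed.

Section extensions.
Context {R : realType} {n m : nat} {M : manifold R n} {N : manifold R m}.
Variables (iota : M -> N) (imm : immersion iota) (g : riemannian_metric N).
Implicit Types (p q : M) (v : 'rV[R]_n) (V W : M -> 'rV[R]_m).

Notation push := (pushforward iota).

(** Orthogonal projection away from the span of the [E i] without division:
    Cramer's rule for their Gram matrix gives the coefficients up to the factor
    [d], the Gram determinant. *)
Lemma gram_orthogonal p r (E : 'I_r -> M -> 'rV[R]_m) W :
  (forall i, smooth_along_at iota p (E i)) -> smooth_along_at iota p W ->
  (forall a : 'I_r -> R, \sum_i a i *: E i p = 0 -> forall i, a i = 0) ->
  exists (c : 'I_r -> M -> R) (d : M -> R),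
    [/\ forall i, smooth_fun_at p (c i), smooth_fun_at p d, d p != 0 &
      forall q k,
        g (iota q) (d q *: W q - \sum_i c i q *: E i q) (E k q) = 0].
Proof.
move=> sE sW free.
pose G q : 'M[R]_r := \matrix_(i, j) g (iota q) (E i q) (E j q).
pose b q : 'rV[R]_r := \row_j g (iota q) (W q) (E j q).
have sG i j : smooth_fun_at p (fun q => G q i j).
  apply: smooth_fun_local (metric_along_smooth imm g (sE i) (sE j)).
  by apply: nearW => q; rewrite mxE.
(* The row of coefficients [c] solves [c *m G = \det G *: b]. *)
exists (fun i q => (b q *m \adj (G q)) 0 i), (fun q => \det (G q)); split.
- move=> i; apply: (@smooth_fun_local _ _ _ _
    (fun q => \sum_j g (iota q) (W q) (E j q) * cofactor (G q) i j)).
    apply: nearW => q; rewrite mxE; apply: eq_bigr => j _.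
    by rewrite [b q 0 j]mxE [\adj (G q) j i]mxE.
  apply: smooth_fun_sum => j; apply: smooth_fun_mul.
    exact (metric_along_smooth imm g sW (sE j)).
  apply: smooth_fun_mul; first exact: smooth_fun_cst.
  apply: smooth_fun_det => k l; apply: smooth_fun_local (sG (lift i k) (lift j l)).
  by apply: nearW => q; rewrite !mxE.
- exact: smooth_fun_det.
(* A row [a] killed by the Gram matrix gives a combination of norm zero. *)
- apply/det0P => -[a a0 aG]; case/eqP: a0; apply/rowP => i; rewrite mxE.
  apply: free; apply: (@metric_definite _ _ _ g (iota p)).
  rewrite metric_sumr big1 // => j _.
  have := congr1 (fun A : 'rV[R]_r => A 0 j) aG; rewrite !mxE => e.
  suff -> : g (iota p) (\sum_i a 0 i *: E i p) (E j p) = 0 by rewrite mulr0.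
  rewrite metric_suml -[RHS]e; apply: eq_bigr => k _.
  by rewrite mxE.
- move=> q k; rewrite metricBl metricZl metric_suml.
  have := congr1 (fun A : 'rV[R]_r => A 0 k)
    (congr1 (mulmx (b q)) (mul_adj_mx (G q))).
  rewrite mulmxA mul_mx_scalar !mxE => <-; apply/eqP; rewrite subr_eq0.
  by apply/eqP; apply: eq_bigr => i _; rewrite [G q i k]mxE.
Qed.

Lemma push_independent p r (X : 'I_r -> 'rV[R]_n) :
  (forall a : 'I_r -> R, \sum_i a i *: X i = 0 -> forall i, a i = 0) ->
  forall a : 'I_r -> R, \sum_i a i *: push p (X i) = 0 -> forall i, a i = 0.
Proof.
move=> free a; rewrite -(linear_comb (push_linear imm p)) => e; apply: free.
apply: (push_inj imm (p := p)).
by rewrite e (linear_fun0 (push_linear imm p)).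
Qed.

(** Projects a constant field along the immersion away from the push-forward of
    the coordinate frame.  This also shows that tangent and normal vectors span
    the ambient tangent space, on which [tangential] depends. *)
Lemma normal_extension p (w : 'rV[R]_m) : exists2 nu,
  normal_field_at iota g p nu & exists u, nu p = w + push p u.
Proof.
pose E i q := push q (coord_field p i q).
have sE i : smooth_along_at iota p (E i).
  exact (smooth_along_push imm (coord_field_smooth p i)).
have sW := smooth_along_restrict imm (const_field_smooth (iota p) w).
have ind a : \sum_i a i *: E i p = 0 -> forall i, a i = 0.
  apply: push_independent => {}a e i.
  have := congr1 (fun A : 'rV[R]_n => A 0 i) e.
  under eq_bigr do rewrite coord_field_center.
  rewrite summxE (bigD1 i) //= big1 => [|j ji]; last first.
    by rewrite !mxE eq_sym (negbTE ji) andbF mulr0.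
  by rewrite !mxE !eqxx mulr1 addr0.
have [c [d [sc sd d0 orth]]] := gram_orthogonal sE sW ind.
pose nu0 q := d q *: const_field (iota p) w (iota q) - \sum_i c i q *: E i q.
have snu0 : smooth_along_at iota p nu0.
  apply: (@smooth_along_local _ _ _ _ _ _ _ (fun q =>
    d q *: (const_field (iota p) w \o iota) q + (-1) *: \sum_i c i q *: E i q)).
    by apply: nearW => q; rewrite scaleN1r.
  apply: (smooth_along_add imm); first exact: (smooth_along_scale imm).
  apply: (smooth_along_scale imm); first exact: smooth_fun_cst.
  exact: (smooth_along_sum imm).
exists (fun q => (d p)^-1 *: nu0 q).
  split; first exact: (smooth_along_scale imm (smooth_fun_cst _ _)).
  have := near_dom (mem_chart_at p); apply: filterS => q pq v /=.
  rewrite metricZl (coord_field_expansion v pq).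
  rewrite (linear_comb (push_linear imm q)) metric_sumr big1 ?mulr0 // => i _.
  by rewrite orth mulr0.
exists (- ((d p)^-1 *: \sum_i c i p *: coord_field p i p)).
rewrite /nu0 const_field_center scalerBr scalerA mulVf // scale1r.
rewrite (linear_funN (push_linear imm p)) (linear_funZ (push_linear imm p)).
by rewrite (linear_comb (push_linear imm p)).
Qed.

Lemma normal_push0 p v : normal iota g p (push p v) -> v = 0.
Proof.
move=> nv; apply: (push_inj imm (p := p)).
rewrite (linear_fun0 (push_linear imm p)).
by apply: (@metric_definite _ _ _ g (iota p)); exact: nv.
Qed.

Lemma tangential_normal p w : normal iota g p (w - push p (tangential iota g p w)).
Proof.
have [nu [_ nnu] [u e]] := normal_extension p w.
apply: (@xgetPex _ 0 [set v | normal iota g p (w - push p v)]).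
exists (- u) => /=; rewrite (linear_funN (push_linear imm p)) opprK -e.
exact: nbhs_singleton nnu.
Qed.

Lemma tangential_unique p w v : normal iota g p (w - push p v) ->
  tangential iota g p w = v.
Proof.
move=> nv; have nt := tangential_normal p w.
apply: subr0_eq; apply: (@normal_push0 p) => u.
rewrite (linear_funB (push_linear imm p)).
have -> : push p (tangential iota g p w) - push p v =
    (w - push p v) - (w - push p (tangential iota g p w)).
  by rewrite opprB [RHS]addrC addrA subrK.
exact (etrans (metricBl _ _ _ _ _)
  (etrans (congr2 (fun a b => a - b) (nv u) (nt u)) (subrr 0))).
Qed.

Variable D : M -> {vspace 'rV[R]_n}.
Hypothesis smooth_D : smooth_distribution D.

Lemma distribution_section p v : v \in D p ->
  exists2 X, section_at (fun q => [set u | u \in D q]) p X & X p = v.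
Proof.
move=> Dv; have [r [X [sX bX]]] := smooth_D p.
have bp := nbhs_singleton bX; have e := coord_basis bp Dv.
exists (fun q => \sum_i coord [tuple X i p | i < r] i v *: X i q).
  split; first by apply: smooth_field_sum => // i; exact: smooth_fun_cst.
  apply: filterS bX => q bq /=; apply: rpred_sum => i _; apply: rpredZ.
  apply: (basis_mem bq); apply/mapP; exists i => //; exact: mem_enum.
rewrite [RHS]e; apply: eq_bigr => i _.
by rewrite -tnth_nth tnth_mktuple.
Qed.

(** The projection of [v] to the orthogonal complement of [D p] extends to a
    section: a constant field is projected away from a local frame of [D]. *)
Lemma orthogonal_section p v : exists2 Z,
  section_at (orthogonal_complement iota g D) p Z & Z p - v \in D p.
Proof.
have [r [X [sX bX]]] := smooth_D p.
pose E i q := push q (X i q).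
have sE i : smooth_along_at iota p (E i) by exact (smooth_along_push imm (sX i)).
have sW := smooth_along_push imm (const_field_smooth p v).
have bp := nbhs_singleton bX.
have ind a : \sum_i a i *: E i p = 0 -> forall i, a i = 0.
  apply: push_independent => {}a e.
  have /freeP := basis_free bp; apply; rewrite -[RHS]e.
  by apply: eq_bigr => i _; rewrite -tnth_nth tnth_mktuple.
have [c [d [sc sd d0 orth]]] := gram_orthogonal sE sW ind.
pose Z0 q := d q *: const_field p v q - \sum_i c i q *: X i q.
have sZ0 : smooth_field_at p Z0.
  apply: (@smooth_field_local _ _ _ _ (fun q =>
    d q *: const_field p v q + (-1) *: \sum_i c i q *: X i q)).
    by apply: nearW => q; rewrite scaleN1r.
  apply: smooth_field_add.
    exact: smooth_field_scale (const_field_smooth p v).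
  apply: smooth_field_scale; first exact: smooth_fun_cst.
  exact: smooth_field_sum.
exists (fun q => (d p)^-1 *: Z0 q).
  split; first exact: smooth_field_scale (smooth_fun_cst _ _) sZ0.
  apply: filterS bX => q bq w Dw; rewrite /induced_metric.
  have lin := push_linear imm q.
  rewrite (linear_funZ lin) metricZl (coord_basis bq Dw) (linear_comb lin).
  rewrite metric_sumr big1 ?mulr0 // => i _.
  rewrite -tnth_nth tnth_mktuple.
  suff -> : push q (Z0 q) = d q *: push q (const_field p v q) - \sum_i c i q *: E i q.
    by rewrite orth mulr0.
  by rewrite (linear_funB lin) (linear_funZ lin) [X in _ - X](linear_comb lin).
rewrite /Z0 const_field_center scalerBr scalerA mulVf // scale1r addrAC subrr add0r.
rewrite rpredN; apply: rpredZ; apply: rpred_sum => i _; apply: rpredZ.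
apply: (basis_mem bp).
by apply/mapP; exists i; rewrite ?mem_enum.
Qed.

Lemma orthogonal_in_D p v : v \in D p -> orthogonal_complement iota g D p v -> v = 0.
Proof.
move=> Dv ov; apply: (@normal_push0 p) => u.
suff -> : push p v = 0 by rewrite metric0l.
by apply: (@metric_definite _ _ _ g (iota p)); exact: ov.
Qed.

End extensions.

(** * Mixed totally geodesic contact CR-submanifolds *)

Section contact_CR_submanifolds.
Context {R : realType} {n m : nat} {M : manifold R n} {N : manifold R m}.
Variables (g : riemannian_metric N) (nb nbs : connection N).
Variables (phi : endo_field N) (xi : N -> 'rV[R]_m) (eta : one_form N).
Variables (iota : M -> N) (D : M -> {vspace 'rV[R]_n}).
Hypotheses (acm : almost_contact_metric g phi xi eta) (tf : torsion_free nb)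
  (dual : dual_connections g nb nbs)
  (sas : sasaki_identity g phi xi nb nbs)
  (sas_dual : sasaki_identity g phi xi nbs nb)
  (cr : contact_CR iota g phi xi D) (mixed : mixed_totally_geodesic iota g nb D).
Implicit Types (p q : M) (v z : 'rV[R]_n) (V W : M -> 'rV[R]_m).

Notation push := (pushforward iota).

Let imm : immersion iota := cr_immersion cr.

(** What is used of mixed total geodesy: such derivatives have no normal part. *)
Lemma mixed_tangent p X Z : section_at (fun q => [set v | v \in D q]) p X ->
  section_at (orthogonal_complement iota g D) p Z ->
  exists u, cov_along iota nb p (X p) (fun q => push q (Z q)) = push p u.
Proof.
move=> sX sZ; have := mixed sX sZ.
by rewrite /second_fundamental_form /normal_part => /subr0_eq e; eexists; exact: e.
Qed.

(** By duality the normal part of the derivative of a tangent field is, up to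
    sign, the dual derivative of a normal field, which is tensorial in the
    tangent field. *)
Lemma cov_tangent_normal_part p v V W nu :
  smooth_along_at iota p V -> smooth_along_at iota p W -> V p = W p ->
  (\forall q \near p, exists u, V q = push q u) ->
  (\forall q \near p, exists u, W q = push q u) ->
  normal_field_at iota g p nu ->
  g (iota p) (cov_along iota nb p v V) (nu p) =
  g (iota p) (cov_along iota nb p v W) (nu p).
Proof.
move=> sV sW VW tV tW [snu nnu].
have zero U : (\forall q \near p, exists u, U q = push q u) ->
    dirderiv p v (fun q => g (iota q) (U q) (nu q)) = 0.
  move=> tU; rewrite -[RHS](dirderiv_cst p v 0); apply: dirderiv_local.
  have := near_and tU nnu; apply: filterS => q [[u ->] nq].
  by rewrite metric_sym nq.
have eV := dual_along imm v dual sV snu; have eW := dual_along imm v dual sW snu.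
rewrite (zero V tV) in eV; rewrite (zero W tW) in eW.
by rewrite VW in eV; apply: (addIr (g (iota p) (W p) (cov_along iota nbs p v nu)));
  rewrite -eV -eW.
Qed.

(** The vector [phi z] is normal, and it is the normal part of [nb_z xi], hence
    of [nb_z zeta] for any section [zeta] of [D] through [xi]; by symmetry of the
    second fundamental form it is the normal part of [nb_xi Z] for a section [Z]
    through [z], which vanishes. *)
Lemma phi_orthogonal0 p z : orthogonal_complement iota g D p z ->
  phi (iota p) (push p z) = 0.
Proof.
move=> oz; set w := phi (iota p) (push p z).
have nw : normal iota g p w := cr_anti_invariant cr oz.
have [nu nnu [u eu]] := normal_extension imm g p w.
have nup : nu p = w.
  have u0 : u = 0.
    apply: (normal_push0 imm (g := g) (p := p)) => v.
    have -> : push p u = nu p - w by rewrite eu addrC addKr.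
    by rewrite metricBl (nbhs_singleton nnu.2 v) (nw v) subrr.
  by rewrite eu u0 (linear_fun0 (push_linear imm p)) addr0.
have [Z sZ Zz] := orthogonal_section imm g (cr_smooth cr) p z.
have Zp : Z p = z.
  apply: subr0_eq; apply: (orthogonal_in_D imm (g := g) Zz) => v Dv.
  rewrite /induced_metric (linear_funB (push_linear imm p)) metricBl.
  have e1 : induced_metric iota g p (Z p) v = 0 by exact: (nbhs_singleton sZ.2 v Dv).
  have e2 : induced_metric iota g p z v = 0 by exact: oz.
  by rewrite /induced_metric in e1 e2; rewrite e1 e2 subrr.
have [x Dx ex] := cr_xi cr p.
have [zeta szeta zetap] := distribution_section (cr_smooth cr) Dx.
have [a ea] := cov_xi acm (iota p) (push p z) sas_dual.
apply: (@metric_definite _ _ _ g (iota p)).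
have -> : g (iota p) w w = g (iota p) (cov_along iota nb p z (xi \o iota)) (nu p).
  rewrite (cov_along_restrict imm nb z (acm_xi_smooth acm (iota p))) nup.
  by rewrite ea metricDl metricZl -ex (metric_sym g _ (push p x)) (nw x) mulr0 addr0.
have sxi := smooth_along_restrict imm (acm_xi_smooth acm (iota p)).
have szetap := smooth_along_push imm szeta.1.
rewrite (@cov_tangent_normal_part p z _ _ nu sxi szetap) //; first last.
- by apply: nearW => q; exists (zeta q).
- by apply: nearW => q; have [y _ ey] := cr_xi cr q; exists y.
- by rewrite /= zetap.
have [y ey] := torsion_along imm tf szeta.1 sZ.1.
rewrite Zp in ey; rewrite ey.
have [t et] := mixed_tangent szeta sZ.
have nnup := nbhs_singleton nnu.2.
rewrite et metricDl (metric_sym g _ (push p t)) (metric_sym g _ (push p y)).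
by rewrite (nnup t) (nnup y) addr0.
Qed.

(** By skewness, [phi w] is normal when [w] is orthogonal to [phi] of every tangent
    vector, and [phi] kills the component orthogonal to [D]. *)
Lemma phi_normal p w : normal iota g p w -> normal iota g p (phi (iota p) w).
Proof.
move=> nw v; have [Z sZ Zv] := orthogonal_section imm g (cr_smooth cr) p v.
have lin := push_linear imm p; have linphi := endo_linear phi (iota p).
have -> : v = Z p - (Z p - v) by rewrite subKr.
have [s _ es] := cr_invariant cr Zv.
rewrite (phi_skew acm) (linear_funB lin) (linear_funB linphi) es.
rewrite (phi_orthogonal0 (nbhs_singleton sZ.2)) sub0r metricNr.
by rewrite (nw s) !oppr0.
Qed.

(** Let [t] be this tangential part and [Z] a section whose value at [p] is the
    component of [t] orthogonal to [D].  By duality [g(Z, nbs_X V)] is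
    [- g(nb_X Z, V)], which vanishes because [nb_X Z] is tangent; so the component
    is orthogonal to [t], and therefore zero. *)
Lemma shape_in_D p X V : section_at (fun q => [set v | v \in D q]) p X ->
  normal_field_at iota g p V ->
  tangential iota g p (cov_along iota nbs p (X p) V) \in D p.
Proof.
move=> sX [sV nV]; set C := cov_along _ _ _ _ _; set t := tangential _ _ _ _.
have lin := push_linear imm p.
have [Z sZ Zt] := orthogonal_section imm g (cr_smooth cr) p t.
have [u eu] := mixed_tangent sX sZ.
have nC : normal iota g p (C - push p t) := tangential_normal imm g p C.
have nVp : normal iota g p (V p) := nbhs_singleton nV.
have gC : g (iota p) (push p (Z p)) C = 0.
  have := dual_along imm (X p) dual (smooth_along_push imm sZ.1) sV.
  rewrite eu (metric_sym g _ (push p u)) (nVp u) add0r => <-.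
  rewrite -[RHS](dirderiv_cst p (X p) 0); apply: dirderiv_local.
  by apply: filterS nV => q nq; rewrite metric_sym nq.
have gt : g (iota p) (push p (Z p)) (push p t) = 0.
  have := nC (Z p); rewrite metricBl (metric_sym g _ C) gC.
  rewrite (metric_sym g _ (push p t)).
  by rewrite sub0r => /eqP; rewrite oppr_eq0 => /eqP.
have Z0 : Z p = 0.
  apply: (normal_push0 imm (g := g) (p := p)).
  suff e : push p (Z p) = 0 by move=> v; rewrite e metric0l.
  apply: (@metric_definite _ _ _ g (iota p)).
  have e : push p (Z p) = push p (Z p - t) + push p t.
    by rewrite -(linear_funD lin) subrK.
  rewrite {2}e metricDr gt addr0.
  exact: (nbhs_singleton sZ.2 _ Zt).
by rewrite Z0 sub0r rpredN in Zt.
Qed.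

(** The equation [nb_X (phi V) = phi (nbs_X V)] is the sum of the two that are
    claimed, because [phi] maps the tangential part of [nbs_X V], which lies in [D],
    to a tangent vector, and its normal part to a normal one. *)
Lemma shape_and_normal_connection p X V :
  section_at (fun q => [set v | v \in D q]) p X ->
  normal_field_at iota g p V ->
  let phiV := fun q => phi (iota q) (V q) in
  [/\ normal iota g p (phiV p),
      push p (shape_operator iota g nb phiV X p) =
        phi (iota p) (push p (shape_operator iota g nbs V X p))
    & normal_connection iota g nb X phiV p =
        phi (iota p) (normal_connection iota g nbs X V p)].
Proof.
move=> sX nV phiV; have nVp : normal iota g p (V p) := nbhs_singleton nV.2.
have lin := push_linear imm p; have linphi := endo_linear phi (iota p).
pose C := cov_along iota nbs p (X p) V.
have eC : cov_along iota nb p (X p) phiV = phi (iota p) C.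
  rewrite (sasaki_along imm (X p) sas nV.1) (nVp (X p)).
  have [x _ <-] := cr_xi cr p.
  by rewrite (nVp x) !scale0r subrr addr0.
have nC : normal iota g p (C - push p (tangential iota g p C)).
  exact: tangential_normal.
have [s _ es] := cr_invariant cr (shape_in_D sX nV); rewrite -/C in es.
have et : tangential iota g p (phi (iota p) C) = s.
  apply: (tangential_unique imm (g := g)).
  have := phi_normal nC.
  by rewrite (linear_funB linphi C (push p (tangential iota g p C))) es.
split.
- exact: phi_normal.
- rewrite /shape_operator eC et -/C (linear_funN lin s).
  by rewrite (linear_funN lin (tangential iota g p C)) (linear_funN linphi) es.
- rewrite /normal_connection /normal_part eC et -/C.
  by rewrite (linear_funB linphi C (push p (tangential iota g p C))) es.
Qed.

End contact_CR_submanifolds.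

Theorem theorem3p15 (R : realType) (n m : nat)
  (M : manifold R n) (N : manifold R m)
  (g : riemannian_metric N) (nb nbs lc : connection N)
  (phi : endo_field N) (xi : N -> 'rV[R]_m) (eta : one_form N)
  (iota : M -> N) (D : M -> {vspace 'rV[R]_n})
  (hN : sasakian_statistical g phi xi eta nb lc)
  (hdual : dual_connections g nb nbs)
  (hM : contact_CR iota g phi xi D) :
  (mixed_totally_geodesic iota g nb D ->
    forall (p : M) (X : M -> 'rV[R]_n) (V : M -> 'rV[R]_m),
      section_at (fun q => [set v | v \in D q]) p X ->
      normal_field_at iota g p V ->
      let phiV := fun q => phi (iota q) (V q) in
      [/\ normal iota g p (phiV p),
          pushforward iota p (shape_operator iota g nb phiV X p) =
            phi (iota p) (pushforward iota p (shape_operator iota g nbs V X p))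
        & normal_connection iota g nb X phiV p =
            phi (iota p) (normal_connection iota g nbs X V p)]) /\
  (mixed_totally_geodesic iota g nbs D ->
    forall (p : M) (X : M -> 'rV[R]_n) (V : M -> 'rV[R]_m),
      section_at (fun q => [set v | v \in D q]) p X ->
      normal_field_at iota g p V ->
      let phiV := fun q => phi (iota q) (V q) in
      [/\ normal iota g p (phiV p),
          pushforward iota p (shape_operator iota g nbs phiV X p) =
            phi (iota p) (pushforward iota p (shape_operator iota g nb V X p))
        & normal_connection iota g nbs X phiV p =
            phi (iota p) (normal_connection iota g nb X V p)]).
Proof.
have acm := sas_acm hN; have stat := sas_statistical hN.
have [sas sas_dual] := sasaki_identities hN hdual.
split=> mixed p X V sX nV.
- exact (shape_and_normal_connection acm stat.1 hdual sas sas_dual hM mixed sX nV).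
- exact (shape_and_normal_connection acm (dual_torsion_free stat hdual)
    (dual_connections_sym hdual) sas_dual sas hM mixed sX nV).
Qed.
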